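(* Let $(E,\phi)$ be a $t$-module of dimension $d$ over $K$, and let $D\in \mathrm{Mat}_{d\times d}(K\{\tau\})\subseteq \mathrm{Mat}_{d\times d}(K(\!(\sigma)\!))$ be the matrix representing $\phi_t$ with respect to a fixed coordinate system. Let $\lambda_d\in K(\!(\sigma)\!)[t]$ be the last invariant factor of $D$. Then the following are equivalent: (1) $E$ is abelian; (2) $E$ is $t$-finite; (3) the Newton polygon of $\lambda_d$ has positive slopes only.
   Context: Let $\mathbb{F}_q$ be the finite field with $q$ elements, $K$ a perfect field containing $\mathbb{F}_q$, and $\ell:\mathbb{F}_q[t]\to K$ an $\mathbb{F}_q$-algebra homomorphism. $K\{\tau\}$ denotes the skew polynomial ring $\{\sum_{i=0}^n\alpha_i\tau^i : \alpha_i\in K\}$ with multiplication determined by $\tau\alpha=\alpha^q\tau$ ($\alpha\in K$); it is identified with the ring of $\mathbb{F}_q$-linear group-scheme endomorphisms of the additive group $\mathbb{G}_a$ over $K$ ($\tau$ = $q$-th power Frobenius, $\alpha$ = scalar multiplication). $K(\!(\sigma)\!)$ denotes the skew field of Laurent series $\sum_{i\ge i_0}\alpha_i\sigma^i$ ($\alpha_i\in K$) with $\sigma\alpha=\alpha^{1/q}\sigma$; it carries the discrete valuation $v$ = order in $\sigma$, with valuation ring $K[\![\sigma]\!]$. $K\{\tau\}$ embeds in $K(\!(\sigma)\!)$ via $\tau\mapsto\sigma^{-1}$. A $t$-module $(E,\phi)$ of dimension $d$ over $K$ is an $\mathbb{F}_q$-vector space scheme $E$ over $K$ isomorphic to $\mathbb{G}_a^d$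 together with an $\mathbb{F}_q$-algebra homomorphism $\phi:\mathbb{F}_q[t]\to\mathrm{End}_{\mathrm{grp},\mathbb{F}_q}(E)$ such that for every $a$, $d\phi_a-\ell(a)$ is nilpotent on $\mathrm{Lie}(E)$. After fixing an isomorphism (coordinate system) $E\cong\mathbb{G}_a^d$ over $K$, each $\phi_a$ is given by a matrix in $\mathrm{Mat}_{d\times d}(K\{\tau\})$ acting on column vectors. The $t$-motive of $E$ is $\mathsf{M}(E)=\mathrm{Hom}_{\mathrm{grp},\mathbb{F}_q}(E,\mathbb{G}_a)$, a $K[t]$-module via post-composition with scalars of $K$ and pre-composition with $\phi_t$; $E$ is called abelian if $\mathsf{M}(E)$ is finitely generated as a $K[t]$-module. The dual $t$-motive is $\check{\mathsf{M}}(E)=\mathrm{Hom}_{\mathrm{grp},\mathbb{F}_q}(\mathbb{G}_a,E)$, a $K[t]$-module via pre-composition with scalar multiplication on $\mathbb{G}_a$ and post-composition with $\phi_t$; $E$ is called $t$-finite if $\check{\mathsf{M}}(E)$ is finitely generated as a $K[t]$-module. Invariant factors: $t$ is a central indeterminate over $K(\!(\sigma)\!)$. By elementary row and column operations over $K(\!(\sigma)\!)[t]$ the matrix $t\mathbf{1}_d-D$ can be brought into diagonal form $\mathrm{diag}(\lambda_1,\dots,\lambda_d)$ with monic $\lambda_i$ such that each $\lambda_i$ is both a left and a right divisor of $\lambda_{i+1}$; these $\lambda_i$ are the invariant factors of $D$ (unique up to similarity; the valuations of their coefficients, hence their Newton polygons, do not depend on the choice). Newton polygon: for $f=\sum_{i=0}^n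 a_it^i$ with coefficients in $K(\!(\sigma)\!)$, its Newton polygon is the lower convex hull of the points $(i,v(a_i))$ with $a_i\neq0$; the slope of an edge from $(i,w_i)$ to $(j,w_j)$ is $(w_j-w_i)/(j-i)$. ''The Newton polygon of $f$ has positive slopes only'' is understood to include that the constant coefficient $a_0$ is non-zero. *)

(* Defs.v *)
From HB Require Import structures.
From mathcomp Require Import all_boot all_order all_algebra.
From Stdlib Require Import ClassicalEpsilon.
Set Implicit Arguments. Unset Strict Implicit. Unset Printing Implicit Defensive.
Import Order.TTheory GRing.Theory Num.Theory.
Local Open Scope ring_scope.

Section TModules.
Variable K : fieldType.
Variable q : nat.

(* ---------- Skew polynomials K{tau}, tau alpha = alpha^q tau ----------
   An element sum_i a_i tau^i is represented by the coefficient
   polynomial {poly K} (only its coefficient list is used); the skew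
   product is skmul. *)
Definition skmul (a b : {poly K}) : {poly K} :=
  \poly_(k < (size a + size b)%N)
     \sum_(i < k.+1) a`_i * (b`_(k - i)) ^+ (q ^ i).

Definition mxskmul m n p (A : 'M[{poly K}]_(m, n)) (B : 'M[{poly K}]_(n, p))
  : 'M[{poly K}]_(m, p) :=
  \matrix_(i, k) \sum_(j < n) skmul (A i j) (B j k).

Definition mxskpow d (D : 'M[{poly K}]_d) (e : nat) : 'M[{poly K}]_d :=
  iter e (mxskmul D) 1%:M.

(* (E, phi) with phi_t = D is a t-module w.r.t. ell(t) = theta :
   d phi_t - theta is nilpotent on Lie E = K^d, d phi_t = tau^0-part of D *)
Definition is_tmodule (theta : K) d (D : 'M[{poly K}]_d) : Prop :=
  exists n : nat,
    iter n (mulmx (map_mx (fun p : {poly K} => p`_0) D - theta%:M)) 1%:M = 0.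

(* t-motive M(E) = Hom(E, G_a) = row vectors over K{tau};
   c in K acts by c * m, t acts by m |-> m D.
   E abelian iff M(E) is a finitely generated K[t]-module. *)
Definition tmod_abelian d (D : 'M[{poly K}]_d) : Prop :=
  exists gens : seq 'rV[{poly K}]_d,
    forall m : 'rV[{poly K}]_d, exists (N : nat) (c : nat -> nat -> K),
      m = \sum_(g < size gens) \sum_(e < N)
            (c g e)%:P *: mxskmul (nth 0 gens g) (mxskpow D e).

(* dual t-motive = Hom(G_a, E) = column vectors over K{tau};
   c in K acts by m |-> m o c (right skew multiplication), t by m |-> D m.
   E t-finite iff it is a finitely generated K[t]-module. *)
Definition tmod_tfinite d (D : 'M[{poly K}]_d) : Prop :=
  exists gens : seq 'cV[{poly K}]_d,
    forall m : 'cV[{poly K}]_d, exists (N : nat) (c : nat -> nat -> K),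
      m = \sum_(g < size gens) \sum_(e < N)
            mxskmul (mxskpow D e)
                    (mxskmul (nth 0 gens g) ((c g e)%:P)%:M : 'cV_d).

(* ---------- Skew Laurent series K((sigma)), sigma alpha = alpha^(1/q) sigma ---------- *)
(* inverse q-Frobenius (well defined as K is perfect) *)
Definition frobinv (x : K) : K := epsilon (inhabits x) (fun y => y ^+ q = x).

(* sigma^i b = (twist i b) sigma^i, i.e. twist i b = b^(q^(-i)) *)
Definition twist (i : int) (b : K) : K :=
  match i with
  | Posz n => iter n frobinv b
  | Negz n => b ^+ (q ^ n.+1)
  end.

(* Elements of K((sigma))[t] (t central):  f k i = coefficient of t^k sigma^i *)
Definition lp := nat -> int -> K.

Definition lpbounded (L : int) (f : lp) : Prop :=
  exists N : nat, forall (k : nat) (i : int), ((N <= k)%N \/ i < L) -> f k i = 0.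

(* product of f (sigma-orders >= L1) and g (sigma-orders >= L2) :
   (a sigma^i t^k)(b sigma^j t^l) = a (twist i b) sigma^(i+j) t^(k+l) *)
Definition lpmul (L1 L2 : int) (f g : lp) : lp := fun k n =>
  if L1 + L2 <= n then
    \sum_(a < k.+1) \sum_(r < (absz (n - L1 - L2)%R).+1)
      f a (L1 + r%:Z) * twist (L1 + r%:Z) (g (k - a)%N (n - (L1 + r%:Z)))
  else 0.

Definition lp0 : lp := fun _ _ => 0.
Definition lp1 : lp := fun k i => if (k == 0%N) && (i == 0) then 1 else 0.

Definition lpmx_bounded d (L : int) (A : 'I_d -> 'I_d -> lp) : Prop :=
  forall i j, lpbounded L (A i j).

Definition lpmxmul d (L1 L2 : int) (A B : 'I_d -> 'I_d -> lp) : 'I_d -> 'I_d -> lp :=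
  fun i k a n => \sum_(j < d) lpmul L1 L2 (A i j) (B j k) a n.

Definition lpmx1 d : 'I_d -> 'I_d -> lp := fun i j => if i == j then lp1 else lp0.

Definition lpdiag d (lam : nat -> lp) : 'I_d -> 'I_d -> lp :=
  fun i j => if i == j then lam (val i) else lp0.

Definition lp_invertible d (L : int) (P : 'I_d -> 'I_d -> lp) : Prop :=
  exists (Pi : 'I_d -> 'I_d -> lp) (Li : int),
    lpmx_bounded Li Pi /\ lpmxmul L Li P Pi = @lpmx1 d /\ lpmxmul Li L Pi P = @lpmx1 d.

(* t 1_d - D, with D embedded via tau |-> sigma^(-1) *)
Definition charmx d (D : 'M[{poly K}]_d) : 'I_d -> 'I_d -> lp :=
  fun i j k n =>
    (if (i == j) && (k == 1%N) && (n == 0) then 1 else 0)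
    - (if (k == 0%N) && (n <= 0) then (D i j)`_(absz n) else 0).

(* a lower bound for the sigma-orders of the entries of t 1_d - D *)
Definition charmx_low d (D : 'M[{poly K}]_d) : int :=
  - (\sum_(i < d) \sum_(j < d) size (D i j))%:Z.

Definition lpmonic (f : lp) : Prop :=
  exists n : nat, (forall i, f n i = (i == 0)%:R) /\
                  (forall k i, (n < k)%N -> f k i = 0).

Definition invariant_factors d (D : 'M[{poly K}]_d) (lam : nat -> lp) : Prop :=
  exists (P Q : 'I_d -> 'I_d -> lp) (LP LQ Ll : int),
    [/\ lpmx_bounded LP P, lpmx_bounded LQ Q,
        lp_invertible LP P, lp_invertible LQ Q &
        lpmxmul (LP + charmx_low D) LQ (lpmxmul LP (charmx_low D) P (charmx D)) Q
          = @lpdiag d lam] /\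
    (forall i, (i < d)%N -> lpbounded Ll (lam i) /\ lpmonic (lam i)) /\
    (forall i, (i.+1 < d)%N ->
       (exists (c : lp) (Lc : int), lpbounded Lc c /\ lam i.+1 = lpmul Ll Lc (lam i) c) /\
       (exists (c : lp) (Lc : int), lpbounded Lc c /\ lam i.+1 = lpmul Lc Ll c (lam i))).

Definition sval_is (a : int -> K) (w : int) : Prop :=
  a w != 0 /\ forall j, j < w -> a j = 0.

(* Newton polygon of f = sum_k a_k t^k has positive slopes only:
   a_0 <> 0, and every edge of the lower convex hull of the points
   (k, v(a_k)) -- i.e. every segment between two such points (i, wi),
   (j, wj), i < j, with all points on or above the line through them --
   has positive slope. *)
Definition np_pos_slopes (f : lp) : Prop :=
  (exists i, f 0%N i != 0) /\
  forall (i j : nat) (wi wj : int), (i < j)%N ->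
    sval_is (f i) wi -> sval_is (f j) wj ->
    (forall (k : nat) (wk : int), sval_is (f k) wk ->
        (wj - wi) * (k%:Z - i%:Z) <= (wk - wi) * (j%:Z - i%:Z)) ->
    wi < wj.

End TModules.

(* Main.v *)
(* Over [L = K((sigma))], all three conditions say that the matrix [D] expands:
   [D] is invertible and its negative powers tend to [0].

   If [E] is abelian, write [tau^s e_r] in terms of the generators and the powers
   of [D], and divide by [tau^s], with [s] larger than the degrees of the
   generators.  This gives [1 = \sum_e A_e D^e] with all [A_e] divisible by
   [sigma]; absorbing [A_0], [D] has a left inverse [U], hence an inverse, and the
   recursion [U^n = \sum_(e >= 1) A_e U^(n-e)] forces [U^n -> 0].  Conversely, if
   [U = D^-n] is divisible by [sigma], the polynomial part [m'] of [m U] has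
   smaller degree than [m], while [m - m' D^n] has bounded degree: Euclidean
   division by [D^n] terminates and gives finitely many generators.  The dual
   [t]-motive is treated by exchanging left and right.

   For the invariant factors write [P (t - D) Q = diag lam] and work modulo the
   left multiples of [t - D], i.e. substitute [t = D].  If [D] expands,
   [1 - t^m Q^-1 D^-m Q], for large [m], is a left multiple of [diag lam], so [lam_d] divides a
   polynomial congruent to [1] modulo [sigma] with constant term [1]; by the Gauss
   lemma the constant coefficient of [lam_d] has strictly smallest valuation,
   which is what positive slopes mean.  Conversely
   [lam_d = lam_d(0) (1 - beta t)] with [beta] divisible by [sigma], and since
   every [lam_i] divides [lam_d] on the right, [(1 - beta t) Q^-1] is a left
   multiple of [t - D]; hence so is [1 - Q beta^m Q^-1 t^m] for all [m], and
   substituting [t = D] shows that [D] expands. *)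
Require Import Defs.
From HB Require Import structures.
From mathcomp Require Import all_boot all_order all_algebra.
From mathcomp Require Import finfield.
From mathcomp Require Import boolp zify.
From Stdlib Require ClassicalEpsilon.
Import Order.TTheory GRing.Theory Num.Theory.
Set Implicit Arguments. Unset Strict Implicit. Unset Printing Implicit Defensive.
Local Open Scope ring_scope.

(** * Skew Laurent series *)

(* Sums of finitely supported families over [int], cut off to the window
   [lo, lo + N); the value does not depend on a window containing the support. *)
Definition wsum (V : nmodType) (lo : int) (N : nat) (F : int -> V) : V :=
  \sum_(r < N) F (lo + r%:Z).

Lemma eq_wsum (V : nmodType) (lo : int) N (F G : int -> V) :
  (forall i, lo <= i -> i < lo + N%:Z -> F i = G i) -> wsum lo N F = wsum lo N G.
Proof. by move=> FG; apply: eq_bigr => r _; apply: FG; have := ltn_ord r; lia. Qed.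

Lemma wsum_widen (V : nmodType) (lo : int) N (lo' : int) N' (F : int -> V) :
  lo' <= lo -> lo + N%:Z <= lo' + N'%:Z ->
  (forall i, (i < lo) || (lo + N%:Z <= i) -> F i = 0) ->
  wsum lo' N' F = wsum lo N F.
Proof.
move=> le1 le2 F0.
have [a Da] : exists a : nat, lo = lo' + a%:Z by exists (absz (lo - lo')%R); lia.
have [b ->] : exists b : nat, N' = (a + N + b)%N.
  by exists (absz (lo' + N'%:Z - lo - N%:Z)%R); lia.
rewrite /wsum !big_split_ord /= big1 ?add0r => [|r _]; last first.
  by apply: F0; have := ltn_ord r; lia.
rewrite [X in _ + X]big1 ?addr0 => [|r _]; last by apply: F0; lia.
by apply: eq_bigr => r _; rewrite Da PoszD addrA.
Qed.

Lemma eq_wsum_window (V : nmodType) (lo : int) N (lo' : int) N' (F : int -> V) :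
  (forall i, (i < lo) || (lo + N%:Z <= i) -> F i = 0) ->
  (forall i, (i < lo') || (lo' + N'%:Z <= i) -> F i = 0) ->
  wsum lo N F = wsum lo' N' F.
Proof.
move=> F0 F0'.
pose l := Order.min lo lo'; pose M := absz (Order.max (lo + N%:Z) (lo' + N'%:Z) - l)%R.
by rewrite -(@wsum_widen _ lo N l M) -1?(@wsum_widen _ lo' N' l M) //; lia.
Qed.

Lemma wsum_shift (V : nmodType) (lo : int) N (F : int -> V) (k : int) :
  wsum lo N (fun i => F (i + k)) = wsum (lo + k) N F.
Proof. by apply: eq_bigr => r _; rewrite addrAC. Qed.

Lemma wsum_exchange (V : nmodType) (lo : int) N (lo' : int) N' (F : int -> int -> V) :
  wsum lo N (fun i => wsum lo' N' (F i)) = wsum lo' N' (fun j => wsum lo N (F^~ j)).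
Proof. exact: exchange_big. Qed.

Lemma wsum0 (V : nmodType) (lo : int) N (F : int -> V) :
  (forall i, F i = 0) -> wsum lo N F = 0.
Proof. by move=> F0; rewrite /wsum big1. Qed.

Lemma wsum1 (V : nmodType) (lo : int) N (F : int -> V) (i0 : int) :
  lo <= i0 -> i0 < lo + N%:Z -> (forall i, i != i0 -> F i = 0) ->
  wsum lo N F = F i0.
Proof.
move=> le1 le2 F0; rewrite (@wsum_widen _ i0 1) ?addr0; try lia.
  by rewrite /wsum big_ord_recl big_ord0 !addr0.
by move=> i Hi; apply: F0; lia.
Qed.

(* [T i c] is the conjugate of [c] by [sigma ^ i]: [sigma^i c = (T i c) sigma^i]. *)
Record twisting (K : fieldType) := Twisting {
  tw :> int -> {rmorphism K -> K};
  tw0 : tw 0 =1 id;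
  twD : forall i j x, tw (i + j) x = tw i (tw j x) }.

Record laurent (K : fieldType) (T : twisting K) := Laurent {
  lcoef :> int -> K;
  lcoef_bounded : exists L : int, forall i : int, i < L -> lcoef i = 0 }.

Section LaurentRing.
Variables (K : fieldType) (T : twisting K).
Local Notation L := (laurent T).

HB.instance Definition _ := gen_eqMixin L.
HB.instance Definition _ := gen_choiceMixin L.

Lemma lauP (x y : L) : (forall n, x n = y n) -> x = y.
Proof.
case: x y => [x xP] [y yP] /= /funext xy; rewrite xy in xP *.
by congr Laurent; apply: Prop_irrelevance.
Qed.

(** Valuation at least [k]; the zero series satisfies this for every [k], so no infinite value is
    needed. *)
Definition lge (k : int) (x : L) := forall i : int, i < k -> x i = 0.

Lemma ex_lge (x : L) : exists k, lge k x.
Proof. exact: lcoef_bounded. Qed.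

Lemma lgeW k k' (x : L) : k' <= k -> lge k x -> lge k' x.
Proof. by move=> kk' xk i ik'; apply: xk; lia. Qed.

Lemma ex_lge2 (x y : L) : exists k, lge k x /\ lge k y.
Proof.
case: (ex_lge x) (ex_lge y) => k kx [l ly]; exists (Order.min k l).
by split; [apply: lgeW kx|apply: lgeW ly]; lia.
Qed.

Lemma lzero_bounded : exists l : int, forall i : int, i < l -> (0 : K) = 0.
Proof. by exists 0. Qed.
Definition lzero : L := Laurent T lzero_bounded.

Lemma ladd_bounded (x y : L) :
  exists l : int, forall i : int, i < l -> x i + y i = 0.
Proof.
by case: (ex_lge2 x y) => k [kx ky]; exists k => i ik; rewrite kx // ky // addr0.
Qed.
Definition ladd (x y : L) : L := Laurent T (ladd_bounded x y).

Lemma lopp_bounded (x : L) : exists l : int, forall i : int, i < l -> - x i = 0.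
Proof. by case: (ex_lge x) => k kx; exists k => i ik; rewrite kx ?oppr0. Qed.
Definition lopp (x : L) : L := Laurent T (lopp_bounded x).

Fact laddA : associative ladd.
Proof. by move=> x y z; apply: lauP => n /=; rewrite addrA. Qed.
Fact laddC : commutative ladd.
Proof. by move=> x y; apply: lauP => n /=; rewrite addrC. Qed.
Fact ladd0 : left_id lzero ladd.
Proof. by move=> x; apply: lauP => n /=; rewrite add0r. Qed.
Fact laddN : left_inverse lzero lopp ladd.
Proof. by move=> x; apply: lauP => n /=; rewrite addNr. Qed.

HB.instance Definition _ := GRing.isZmodule.Build L laddA laddC ladd0 laddN.

Definition low (x : L) : int := projT1 (cid (ex_lge x)).
Lemma lge_low x : lge (low x) x.
Proof. exact: projT2 (cid (ex_lge x)). Qed.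

(** Nonzero terms have [low x <= i <= n - low y]. When this interval is empty, [absz] still produces
    a window, on which all terms vanish. *)
Definition lmulc (x y : L) (n : int) : K :=
  wsum (low x) (absz (n - low x - low y)%R).+1 (fun i => x i * T i (y (n - i))).

(** Frees the product from the chosen bounds [low], so that the windows of several products can be
    aligned. *)
Lemma lmulcE lx ly (x y : L) lo N n :
  lge lx x -> lge ly y -> lo <= lx -> n - ly < lo + N%:Z ->
  lmulc x y n = wsum lo N (fun i => x i * T i (y (n - i))).
Proof.
have aux kx ky : lge kx x -> lge ky y ->
    forall i, (i < kx) || (n - ky < i) -> x i * T i (y (n - i)) = 0.
  move=> Hx Hy i /orP[ik|ik]; first by rewrite Hx ?mul0r.
  by rewrite (Hy (n - i)) ?rmorph0 ?mulr0 //; lia.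
move=> Hx Hy le1 le2; apply: eq_wsum_window => i Hi.
  by apply: (aux _ _ (@lge_low x) (@lge_low y)); lia.
by apply: (aux _ _ Hx Hy); lia.
Qed.

Lemma lmulc_lge k l (x y : L) n : lge k x -> lge l y -> n < k + l -> lmulc x y n = 0.
Proof.
move=> Hx Hy nkl; rewrite (@lmulcE k l _ _ k 0 n) //; last by lia.
by rewrite /wsum big_ord0.
Qed.

Lemma lmul_bounded (x y : L) : exists l : int, forall i : int, i < l -> lmulc x y i = 0.
Proof.
by exists (low x + low y) => i; apply: lmulc_lge; apply: lge_low.
Qed.
Definition lmul (x y : L) : L := Laurent T (lmul_bounded x y).

Lemma lmon_bounded (k : int) (c : K) :
  exists l : int, forall i : int, i < l -> (if i == k then c else 0) = 0.
Proof. by exists k => i ik; case: eqP => // ?; lia. Qed.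
Definition lmon k c : L := Laurent T (lmon_bounded k c).
Definition lone : L := lmon 0 1.

Lemma lge_lmon k c : lge k (lmon k c).
Proof. by move=> i ik /=; case: eqP => // ?; lia. Qed.

Lemma lmul_lmonl k c (x : L) n : lmul (lmon k c) x n = c * T k (x (n - k)).
Proof.
case: (ex_lge x) => l lx /=.
rewrite (@lmulcE k l _ _ k (absz (n - l - k)%R).+1 n) //; [|exact: lge_lmon|lia].
rewrite (@wsum1 _ _ _ _ k) /= ?eqxx //; try lia.
by move=> i /= /negPf ->; rewrite mul0r.
Qed.

Lemma lmul_lmonr k c (x : L) n : lmul x (lmon k c) n = x (n - k) * T (n - k) c.
Proof.
case: (ex_lge x) => l lx /=.
rewrite (@lmulcE l k _ _ (Order.min l (n - k)) (absz (n - k - l)%R).+1 n) //; try lia.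
  rewrite (@wsum1 _ _ _ _ (n - k)) /=; try lia; first by rewrite ifT //; lia.
  by move=> i Hi; rewrite ifF ?rmorph0 ?mulr0 //; lia.
exact: lge_lmon.
Qed.

Fact lmulA : associative lmul.
Proof.
move=> x y z; apply: lauP => n.
move: (low x) (low y) (low z) (@lge_low x) (@lge_low y) (@lge_low z).
move=> a b c Hx Hy Hz.
have Hxy : lge (a + b) (lmul x y) by move=> i; apply: lmulc_lge.
have Hyz : lge (b + c) (lmul y z) by move=> i; apply: lmulc_lge.
pose N := (absz (n - a - b - c)%R).+1.
(* Both bracketings become one double sum, in which [j] is the order taken from [x] and [i] the
   total order taken from [x] and [y]. *)
have -> : lmul x (lmul y z) n = wsum a N (fun j => wsum (a + b) N (fun i =>
    x j * T j (y (i - j)) * T i (z (n - i)))).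
  rewrite [LHS](@lmulcE a (b + c) _ _ a N) //; try lia.
  apply: eq_wsum => j j1 j2.
  rewrite [lmul y z _](@lmulcE b c _ _ (a + b - j) N) //; try lia.
  rewrite -wsum_shift /wsum rmorph_sum mulr_sumr; apply: eq_bigr => r _.
  rewrite rmorphM -twD mulrA.
  by congr (_ * T _ (y _) * T _ (z _)); lia.
rewrite wsum_exchange [RHS](@lmulcE (a + b) c _ _ (a + b) N) //; try lia.
apply: eq_wsum => i i1 i2; rewrite [lmul x y i](@lmulcE a b _ _ a N) //; try lia.
by rewrite /wsum mulr_suml.
Qed.

Fact lmul1l : left_id lone lmul.
Proof. by move=> x; apply: lauP => n; rewrite lmul_lmonl mul1r tw0 subr0. Qed.
Fact lmul1r : right_id lone lmul.
Proof. by move=> x; apply: lauP => n; rewrite lmul_lmonr rmorph1 mulr1 subr0. Qed.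

Fact lmulDl : left_distributive lmul +%R.
Proof.
move=> x y z; apply: lauP => n.
have [k [kx ky]] := ex_lge2 x y; have [l lz] := ex_lge z.
pose N := (absz (n - k - l)%R).+1.
have kxy : lge k (x + y) by move=> i ik; rewrite /= kx // ky // addr0.
rewrite [LHS](@lmulcE k l _ _ k N) // ?[RHS]/=; try lia.
rewrite (@lmulcE k l x _ k N) ?(@lmulcE k l y _ k N) //; try lia.
by rewrite /wsum -big_split; apply: eq_bigr => r _; rewrite mulrDl.
Qed.
Fact lmulDr : right_distributive lmul +%R.
Proof.
move=> z x y; apply: lauP => n.
have [k [kx ky]] := ex_lge2 x y; have [l lz] := ex_lge z.
pose N := (absz (n - k - l)%R).+1.
have kxy : lge k (x + y) by move=> i ik; rewrite /= kx // ky // addr0.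
rewrite [LHS](@lmulcE l k _ _ l N) // ?[RHS]/=; try lia.
rewrite (@lmulcE l k _ x l N) ?(@lmulcE l k _ y l N) //; try lia.
by rewrite /wsum -big_split; apply: eq_bigr => r _; rewrite rmorphD mulrDr.
Qed.

Fact lone_neq0 : lone != 0.
Proof.
by apply/eqP => /(congr1 (fun x : L => x 0)) /=; apply/eqP; rewrite oner_neq0.
Qed.

HB.instance Definition _ :=
  GRing.Zmodule_isNzRing.Build L lmulA lmul1l lmul1r lmulDl lmulDr lone_neq0.

End LaurentRing.

(** * Valuations and inverses *)

(** Gives common lower bounds for the orders of finitely many series: minus the largest absolute
    value lies below each single bound. *)
Lemma uniform_bound (I : finType) (P : int -> I -> Prop) :
  (forall i k k', k' <= k -> P k i -> P k' i) -> (forall i, exists k, P k i) ->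
  exists k, forall i, P k i.
Proof.
move=> Pmon /fin_all_exists[k Pk]; exists (- (\max_i absz (k i))%:Z) => i.
apply: Pmon (Pk i); have := @leq_bigmax _ (fun i => absz (k i)) i; lia.
Qed.

Section Valuation.
Variables (K : fieldType) (T : twisting K).
Local Notation L := (laurent T).

Lemma lge0 k : lge k (0 : L). Proof. by []. Qed.

Lemma lgeD k (x y : L) : lge k x -> lge k y -> lge k (x + y).
Proof. by move=> kx ky i ik; rewrite /= kx // ky // addr0. Qed.

Lemma lgeN k (x : L) : lge k x -> lge k (- x).
Proof. by move=> kx i ik; rewrite /= kx // oppr0. Qed.

Lemma lgeM k l (x y : L) : lge k x -> lge l y -> lge (k + l) (x * y).
Proof. by move=> kx ly i; apply: lmulc_lge. Qed.

Lemma lge1 : lge 0 (1 : L).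
Proof. exact: lge_lmon. Qed.

Lemma lge_sum I (r : seq I) (P : pred I) k (F : I -> L) :
  (forall i, P i -> lge k (F i)) -> lge k (\sum_(i <- r | P i) F i).
Proof. by move=> Fk; elim/big_ind: _ => //; apply: lgeD. Qed.

Lemma lge_eq0 (x : L) : (forall n : nat, lge n%:Z x) -> x = 0.
Proof.
move=> x0; apply: lauP => i; apply: (x0 (absz i).+1); lia.
Qed.

Lemma lau_sumE I (r : seq I) (P : pred I) (F : I -> L) n :
  (\sum_(i <- r | P i) F i) n = \sum_(i <- r | P i) F i n.
Proof. by elim/big_rec2: _ => // i y x _ <-. Qed.

Lemma lmulE lx ly (x y : L) lo N n :
  lge lx x -> lge ly y -> lo <= lx -> n - ly < lo + N%:Z ->
  (x * y) n = wsum lo N (fun i => x i * T i (y (n - i))).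
Proof. exact: lmulcE. Qed.

Lemma lead_lmul k l (x y : L) : lge k x -> lge l y ->
  (x * y) (k + l) = x k * T k (y l).
Proof.
move=> kx ly; rewrite (@lmulE k l _ _ k 1) //; last lia.
by rewrite /wsum big_ord_recl big_ord0 /= !addr0 addrAC subrr add0r.
Qed.

Lemma lmonM k l c c' : lmon T k c * lmon T l c' = lmon T (k + l) (c * T k c').
Proof.
apply: lauP => n; rewrite [LHS]lmul_lmonl /=.
case: eqP => [?|?]; first by rewrite ifT //; lia.
by rewrite ifF ?rmorph0 ?mulr0 //; lia.
Qed.

Lemma lmon1 : lmon T 0 1 = 1.
Proof. by []. Qed.

Definition mge k m n (A : 'M[L]_(m, n)) := forall i j, lge k (A i j).

Lemma mgeW k k' m n (A : 'M[L]_(m, n)) : k' <= k -> mge k A -> mge k' A.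
Proof. by move=> kk' kA i j; apply: lgeW (kA i j). Qed.

Lemma ex_mge m n (A : 'M[L]_(m, n)) : exists k, mge k A.
Proof.
have [|i|k kA] := @uniform_bound ('I_m * 'I_n)%type (fun k i => lge k (A i.1 i.2)).
- by move=> i k k'; apply: lgeW.
- exact: ex_lge.
by exists k => i j; apply: (kA (i, j)).
Qed.

Lemma mge0 k m n : mge k (0 : 'M[L]_(m, n)).
Proof. by move=> i j; rewrite mxE. Qed.

Lemma mgeD k m n (A B : 'M[L]_(m, n)) : mge k A -> mge k B -> mge k (A + B).
Proof. by move=> kA kB i j; rewrite mxE; apply: lgeD. Qed.

Lemma mgeN k m n (A : 'M[L]_(m, n)) : mge k A -> mge k (- A).
Proof. by move=> kA i j; rewrite mxE; apply: lgeN. Qed.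

Lemma mge_sum I (r : seq I) (P : pred I) k m n (F : I -> 'M[L]_(m, n)) :
  (forall i, P i -> mge k (F i)) -> mge k (\sum_(i <- r | P i) F i).
Proof. by move=> Fk; elim/big_ind: _ => //; [apply: mge0|apply: mgeD]. Qed.

Lemma mge_mulmx k l m n p (A : 'M[L]_(m, n)) (B : 'M[L]_(n, p)) :
  mge k A -> mge l B -> mge (k + l) (A *m B).
Proof. by move=> kA lB i j; rewrite mxE; apply: lge_sum => r _; apply: lgeM. Qed.

Lemma mge_scalar k n (a : L) : lge k a -> mge k (a%:M : 'M_n).
Proof. by move=> ka i j; rewrite mxE; case: (i == j). Qed.

Lemma mge_eq0 m n (A : 'M[L]_(m, n)) : (forall k : nat, mge k%:Z A) -> A = 0.
Proof. by move=> A0; apply/matrixP => i j; rewrite mxE; apply: lge_eq0 => k; apply: A0. Qed.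

Section SquareMatrix.
Variable d : nat.
Local Notation M := 'M[L]_d.+1.

Lemma mge1 : mge 0 (1 : M).
Proof. exact/mge_scalar/lge1. Qed.

Lemma mgeM k l (A B : M) : mge k A -> mge l B -> mge (k + l) (A * B).
Proof. exact: mge_mulmx. Qed.

Lemma mgeX (A : M) n : mge 1 A -> mge n%:Z (A ^+ n).
Proof.
move=> A1; elim: n => [|n IHn]; first exact: mge1.
by rewrite exprS -addn1 addnC PoszD; apply: mgeM.
Qed.

(* The geometric series [\sum_k B ^+ k] converges coefficientwise. *)
Lemma geometric_series (B : M) : mge 1 B ->
  exists C, [/\ mge 0 C, C * (1 - B) = 1 & (1 - B) * C = 1].
Proof.
move=> B1; pose S n := \sum_(k < n) B ^+ k.
have S0 n : mge 0 (S n) by apply: mge_sum => k _; apply: (@mgeW k%:Z) => //; apply: mgeX.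
(* From [S p] on, the partial sums agree below order [p]; hence for [n >= 0] the coefficient at [n]
   can be read off from [S n.+1]. *)
have SD p r : mge p%:Z (S (p + r)%N - S p).
  rewrite /S big_split_ord /= addrAC subrr add0r; apply: mge_sum => k _.
  by apply: (@mgeW (p + k)%N%:Z); [rewrite PoszD lerDl|apply: mgeX].
have Cb i j : exists l : int, forall n : int, n < l ->
    (if n < 0 then 0 else S (absz n).+1 i j n) = 0.
  by exists 0 => n ->.
pose C : M := \matrix_(i, j) Laurent T (Cb i j).
have CS N : mge N%:Z (C - S N).
  move=> i j n nN; rewrite !mxE /=; case: ifP => n0.
    by rewrite S0 ?subr0.
  have [p [Dn ltpN]] : exists p : nat, n = p%:Z /\ (p < N)%N by exists (absz n); lia.
  have := @SD p.+1 (N - p.+1)%N i j n; rewrite subnKC // Dn !mxE /= => /(_ _) E.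
  by rewrite -[_ - _]opprB E ?oppr0 //; lia.
have BS n : (1 - B) * S n = 1 - B ^+ n by rewrite -opprB mulNr -subrX1 opprB.
have SB n : S n * (1 - B) = 1 - B ^+ n.
  rewrite -BS; apply/commr_sym/commr_sum => k _.
  apply/commrX/commr_sym/commrB => //.
  exact: commr1.
have C0 : mge 0 C.
  by move=> i j n n0; rewrite mxE /= n0.
have mB : mge 0 (1 - B) by apply: mgeD mge1 (mgeN (mgeW _ B1)).
exists C; split => //; apply/eqP; rewrite -subr_eq0; apply/eqP/mge_eq0 => k.
  (* The difference of the two sides has order at least [k] for every [k], hence is zero. *)
  have -> : C * (1 - B) - 1 = (C - S k) * (1 - B) - B ^+ k.
    by rewrite mulrBl SB opprB addrA addrAC addrK.
  apply/mgeD/mgeN/mgeX => //; rewrite -[k%:Z]addr0; exact: mgeM.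
have -> : (1 - B) * C - 1 = (1 - B) * (C - S k) - B ^+ k.
  by rewrite mulrBr BS opprB addrA addrAC addrK.
apply/mgeD/mgeN/mgeX => //; rewrite -[k%:Z]add0r; exact: mgeM.
Qed.

End SquareMatrix.

(** A monomial [m] on the left normalises [x] to a series [z] with leading term [1] at order [0];
    the geometric series, taken for 1 by 1 matrices, inverts [z]. *)
Lemma lau_inverse w (x : L) : lge w x -> x w != 0 ->
  exists y, [/\ lge (- w) y, y * x = 1 & x * y = 1].
Proof.
move=> xw xw0; pose c := (T (- w) (x w))^-1.
have c0 : c != 0 by rewrite invr_eq0 fmorph_eq0.
pose m := lmon T (- w) c; pose m' := lmon T w (T w c^-1).
have mm' : m * m' = 1.
  by rewrite lmonM -twD addNr tw0 mulfV.
have m'm : m' * m = 1.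
  by rewrite lmonM -rmorphM mulVf // rmorph1 subrr.
pose z := m * x.
have z0 : lge 0 z by rewrite -(addNr w); apply: lgeM => //; apply: lge_lmon.
have z1 : z 0 = 1.
  by rewrite -(addNr w) lead_lmul //=; [rewrite eqxx mulVf ?fmorph_eq0|apply: lge_lmon].
have [|C [C0 Cz zC]] := @geometric_series 0 (1 - z%:M).
  move=> i j n n1; rewrite !ord1 !mxE /= -[lmulc m x n]/(z n); have [->|n0] := eqVneq n 0.
    by rewrite z1 subrr.
  by rewrite z0 ?oppr0 ?addr0 //; lia.
rewrite opprB addrC subrK in Cz zC.
have /(congr1 (fun A : 'M_1 => A 0 0)) := Cz.
have /(congr1 (fun A : 'M_1 => A 0 0)) := zC.
rewrite !mxE !big_ord1 !mxE eqxx !mulr1n; set z' := C 0 0 => zz' z'z.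
exists (z' * m); split; first by have := lgeM (C0 0 0) (@lge_lmon _ T (- w) c); rewrite add0r.
  by rewrite -mulrA.
(* Since [x = m' * z], the inverse of [z] also yields a right inverse of [x]. *)
transitivity (m' * (z * z') * m); first by rewrite !mulrA m'm mul1r.
by rewrite zz' mulr1.
Qed.

Lemma lval_ex (x : L) : x != 0 -> exists w, lge w x /\ x w != 0.
Proof.
move=> x0; have [k kx] := ex_lge x.
have [n xn] : exists n : nat, x (k + n%:Z) != 0.
  apply: contrapT => H; case/eqP: x0; apply: lauP => i.
  have [/kx //|ki] := ltP i k.
  apply/eqP; apply: contrapT => /negP xi; apply: H; exists (absz (i - k)%R).
  by rewrite (_ : k + _ = i) //; lia.
case: (@ex_minnP (fun n : nat => x (k + n%:Z) != 0)); first by exists n.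
move=> m xm mmin; exists (k + m%:Z); split=> // i im.
have [/kx //|ki] := ltP i k; apply/eqP; apply: contraT => xi.
have := mmin (absz (i - k)%R); rewrite (_ : k + _ = i); last lia.
by move=> /(_ xi); lia.
Qed.

Lemma lau_div (x : L) : x != 0 -> exists y, y * x = 1 /\ x * y = 1.
Proof.
by case/lval_ex => w [xw xw0]; have [y []] := lau_inverse xw xw0; exists y.
Qed.

End Valuation.

(** * Linear algebra over a division ring *)

Section DivisionRing.
Variable R : nzRingType.
Hypothesis divR : forall x : R, x != 0 -> exists y, y * x = 1 /\ x * y = 1.

(** Gaussian elimination, by induction on the number of columns: a zero first column is dropped,
    otherwise a pivot row clears it and is discarded. *)
Lemma rows_dependent n m (A : 'M[R]_(m, n)) : (n < m)%N ->
  exists2 x : 'rV_m, x != 0 & x *m A = 0.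
Proof.
elim: n m A => [|n IHn] [//|m] A ltnm.
  exists (const_mx 1); last by apply/matrixP => i [].
  by apply/eqP => /matrixP/(_ 0 0); rewrite !mxE; apply/eqP/oner_neq0.
move: A; rewrite -[n.+1]/(1 + n)%N => A.
have [a0|[i ai]] : lsubmx A = 0 \/ exists i, lsubmx A i 0 != 0.
  have [/existsP|/existsPn H] := boolP [exists i, lsubmx A i 0 != 0]; [by right|left].
  by apply/matrixP => i j; rewrite ord1 [RHS]mxE; apply/eqP; have := H i; rewrite negbK.
  have [x x0 xA] := IHn m.+1 (rsubmx A) (ltnW ltnm).
  by exists x => //; rewrite -[A]hsubmxK mul_mx_row a0 mulmx0 xA row_mx0.
have [b [ba _]] := divR ai.
(* Left multiplication by [E] removes row [i] and subtracts from every other row the multiple of row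
   [i] that kills its first entry. *)
pose E : 'M[R]_(m, m.+1) :=
  \matrix_(k, j) ((lift i k == j)%:R - (lsubmx A (lift i k) 0 * b) *+ (j == i)).
have [x x0 xEB] := IHn m (E *m rsubmx A) ltnm.
exists (x *m E).
  (* The entry of [x *m E] at [lift i k] is the entry [k] of [x], so a nonzero relation stays
     nonzero. *)
  apply: contra_neq x0 => /matrixP xE0; apply/matrixP => r k.
  have := xE0 r (lift i k); rewrite !mxE (bigD1 k) //= big1 ?addr0 => [<-|l lk].
    by rewrite mxE eqxx eq_sym (negPf (neq_lift _ _)) mulr0n subr0 mulr1.
  by rewrite mxE (inj_eq lift_inj) (negPf lk) eq_sym (negPf (neq_lift _ _)) mulr0n subr0 mulr0.
rewrite -[A]hsubmxK mul_mx_row -[X in row_mx _ X]mulmxA xEB.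
suff -> : x *m E *m lsubmx A = 0 by rewrite row_mx0.
rewrite -mulmxA; suff -> : E *m lsubmx A = 0 by rewrite mulmx0.
apply/matrixP => k j; rewrite ord1 [LHS]mxE [RHS]mxE.
under eq_bigr do rewrite mxE mulrBl.
rewrite sumrB (bigD1 (lift i k)) //= eqxx mul1r big1 ?addr0 => [|l /negPf]; last first.
  by rewrite eq_sym => ->; rewrite mul0r.
rewrite (bigD1 i) //= eqxx -mulrA ba mulr1 big1 ?addr0 ?subrr // => l /negPf->.
by rewrite mul0r.
Qed.

(* Otherwise a nonzero row of [1 - B A], which is killed by [B], would be
   independent of the [n] rows of [A]. *)
Lemma mulmx1_comm n (A B : 'M[R]_n) : A *m B = 1%:M -> B *m A = 1%:M.
Proof.
move=> AB1; pose F := 1%:M - B *m A.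
have FB : F *m B = 0 by rewrite mulmxBl mul1mx -mulmxA AB1 mulmx1 subrr.
suff F0 : F = 0 by apply/esym/eqP; rewrite -subr_eq0 -/F F0.
apply/row_matrixP => i; rewrite row0.
have ltn1 : (n < n + 1)%N by rewrite addn1.
have [x x0 xA] := rows_dependent (col_mx A (row i F)) ltn1.
(* Multiplying by [B] isolates the coefficients of the rows of [A], because [A B = 1] and [F B = 0].
   They vanish, so the remaining coefficient is nonzero. *)
have := congr1 (mulmx^~ B) xA.
rewrite -[x]hsubmxK mul_row_col mulmxDl mul0mx -!mulmxA AB1 mulmx1.
rewrite -row_mul FB row0 mulmx0 addr0 => xl.
move: xA x0; rewrite -[x]hsubmxK mul_row_col xl mul0mx add0r.
set y := rsubmx x => yF x0.
have y0 : y 0 0 != 0.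
  by apply: contra_neq x0 => y0; rewrite [y]mx11_scalar y0 scalar_mx_is_semi_additive row_mx0.
have [z [zy _]] := divR y0.
rewrite -[row i F]mul1mx (_ : 1%:M = z%:M *m y) -?mulmxA ?yF ?mulmx0 //.
by rewrite [y]mx11_scalar -scalar_mxM zy.
Qed.

End DivisionRing.

(** * Expanding matrices and invariant factors *)

Section GaussLemma.
Variables (K : fieldType) (T : twisting K).
Local Notation L := (laurent T).

Definition leading_part (w : int) (f : {poly L}) : {poly K} :=
  map_poly (fun x : L => x w) f.

Lemma coef_leading_part w f k : (leading_part w f)`_k = f`_k w.
Proof. by rewrite coef_map_id0. Qed.

Lemma lge_coefM k l (p r : {poly L}) : (forall i, lge k p`_i) ->
  (forall i, lge l r`_i) -> forall i, lge (k + l) (p * r)`_i.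
Proof. by move=> kp lr i; rewrite coefM; apply: lge_sum => j _; apply: lgeM. Qed.

(* The product of leading parts lives in the domain [{poly K}]. *)
Lemma leading_partM k l (p r : {poly L}) : (forall i, lge k p`_i) ->
  (forall i, lge l r`_i) ->
  leading_part (k + l) (p * r) = leading_part k p * map_poly (T k) (leading_part l r).
Proof.
move=> kp lr; apply/polyP => i; rewrite coef_leading_part !coefM lau_sumE.
apply: eq_bigr => j _; rewrite lead_lmul ?coef_leading_part //.
by rewrite coef_map coef_leading_part.
Qed.

(** The Gauss valuation of [f], found as the least offset from a common lower bound at which some
    coefficient is nonzero. *)
Lemma gauss_valuation (f : {poly L}) : f != 0 ->
  exists w, (forall k, lge w f`_k) /\ leading_part w f != 0.
Proof.
move=> f0.
have [|i|l lf'] := @uniform_bound 'I_(size f) (fun k i => lge k f`_i).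
- by move=> i k k'; apply: lgeW.
- exact: ex_lge.
have lf k : lge l f`_k.
  have [ks|sk] := ltnP k (size f); first exact: (lf' (Ordinal ks)).
  by rewrite nth_default //; apply: lge0.
have ex_n : exists n : nat, [exists k : 'I_(size f), f`_k (l + n%:Z) != 0].
  have [w [lw fw]] : exists w, lge w (lead_coef f) /\ lead_coef f w != 0.
    by apply: lval_ex; rewrite lead_coef_eq0.
  have s0 : ((size f).-1 < size f)%N by rewrite ltn_predL size_poly_gt0.
  exists (absz (w - l)%R); apply/existsP; exists (Ordinal s0) => /=.
  rewrite (_ : l + _ = w) //; have [|lw'] := leP l w; first by lia.
  by case/eqP: fw; apply: lf.
case: (ex_minnP ex_n) => n /existsP[k fk] nmin; exists (l + n%:Z); split.
  move=> i j jl; have [/lf //|lj] := ltP j l; apply/eqP; apply: contraT => fij.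
  have si : (i < size f)%N.
    by rewrite ltnNge; apply: contra_neqN fij => si; rewrite nth_default.
  have := nmin (absz (j - l)%R); suff Dj : l + (absz (j - l)%R)%:Z = j; last by lia.
  rewrite Dj => /(_ _); have -> : [exists k0 : 'I_(size f), f`_k0 j != 0].
    by apply/existsP; exists (Ordinal si).
  by move=> /(_ isT); lia.
by apply: contra_neq fk => /polyP/(_ k); rewrite coef_leading_part coef0.
Qed.

(** Working form of the condition on the Newton polygon; the equivalence is [np_pos_slopesE]. *)
Definition dominant_const (f : {poly L}) : Prop :=
  exists w, [/\ lge w f`_0, f`_0 w != 0 & forall k, (0 < k)%N -> lge (w + 1) f`_k].

(** The leading part of [c * f] is a constant, and degrees add in [{poly K}], so the leading part of
    [f] is a nonzero constant as well. *)
Lemma dominant_const_factor (c f : {poly L}) : (c * f)`_0 = 1 ->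
  (forall k, (0 < k)%N -> lge 1 (c * f)`_k) -> dominant_const f.
Proof.
move=> cf0 cfk.
have /andP[c0 f0] : (c != 0) && (f != 0).
  rewrite -negb_or; apply/negP => /orP[]/eqP E; move/eqP: cf0.
    by rewrite E mul0r coef0 eq_sym oner_eq0.
  by rewrite E mulr0 coef0 eq_sym oner_eq0.
have [v [cv lc]] := gauss_valuation c0; have [w [fw lf]] := gauss_valuation f0.
have cfE := leading_partM cv fw.
have lf' : map_poly (T v) (leading_part w f) != 0 by rewrite map_poly_eq0.
have vw0 : v + w <= 0.
  rewrite leNgt; apply/negP => vw; have /(_ _ vw) := lge_coefM cv fw 0.
  by rewrite cf0 /= => /eqP; rewrite oner_eq0.
(* Coefficients of positive degree have order at least 1, which exceeds [v + w], so they contribute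
   nothing to the leading part. *)
have scf : (size (leading_part (v + w) (c * f)) <= 1)%N.
  by apply/leq_sizeP => k k0; rewrite coef_leading_part cfk //; lia.
have sf : (size (leading_part w f) <= 1)%N.
  move: scf; rewrite cfE size_mul // size_map_poly.
  have : (0 < size (leading_part v c))%N by rewrite size_poly_gt0.
  by case: (size _) => // n _; rewrite addSn /= => /(leq_trans (leq_addl _ _)).
exists w; split => //.
  apply: contra_neq lf => f00; apply/polyP => k; rewrite coef_leading_part coef0.
  by case: k => // k; rewrite -coef_leading_part nth_default //; apply: leq_trans sf _.
move=> k k0 i iw; have [iw'|wi] := ltP i w; first exact: fw.
have -> : i = w by lia.
by rewrite -coef_leading_part nth_default //; apply: leq_trans sf _.
Qed.

End GaussLemma.

(** * Matrices whose negative powers tend to zero *)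

Section Contraction.
Variables (K : fieldType) (T : twisting K) (d : nat).
Local Notation L := (laurent T).
Local Notation M := 'M[L]_d.+1.

(** [U] itself may have negative order; only its high powers have to be small. *)
Definition expanding (D : M) : Prop := exists U, [/\ U * D = 1, D * U = 1 &
  forall k : nat, exists n, forall m, (n <= m)%N -> mge k%:Z (U ^+ m)].

(** Starting from a common bound [c] for the powers up to [J], the order grows by one each time the
    exponent advances by [J + 1]. *)
Lemma powers_vanish (U : M) J :
  (forall n l, (J < n)%N -> (forall e, (e <= J)%N -> mge l (U ^+ (n - e.+1))) ->
     mge (l + 1) (U ^+ n)) ->
  forall k : nat, exists n, forall m, (n <= m)%N -> mge k%:Z (U ^+ m).
Proof.
move=> step; have [|i|c Uc] := @uniform_bound 'I_J.+1 (fun k i => mge k (U ^+ i)).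
- by move=> i k k'; apply: mgeW.
- exact: ex_mge.
have Uck k n : (J.+1 * k <= n)%N -> mge (c + k%:Z) (U ^+ n).
  elim/ltn_ind: n k => n IHn k kn; have [nJ|Jn] := leqP n J.
    have -> : k = 0%N by nia.
    by rewrite addr0; apply: (Uc (Ordinal (nJ : (n < J.+1)%N))).
  have := step n (c + k.-1%:Z) Jn; case: k kn => [|k] kn H.
    apply/(@mgeW _ _ (c + 1)); first by lia.
    by rewrite -[c]addr0; apply: H => e eJ; apply: IHn; lia.
  rewrite -[k.+1]addn1 PoszD addrA; apply: H => e eJ /=; apply: IHn; nia.
move=> k; exists (J.+1 * absz (k%:Z - c)%R)%N => m km.
by apply: mgeW (Uck _ _ km); lia.
Qed.

Lemma mulUD n e (D U : M) : U * D = 1 -> D * U = 1 -> (e <= n)%N ->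
  D ^+ e * U ^+ n = U ^+ (n - e) /\ U ^+ n * D ^+ e = U ^+ (n - e).
Proof.
move=> UD DU en; have cUD : GRing.comm U D by rewrite /GRing.comm UD DU.
split.
  by rewrite -{1}(subnKC en) exprD mulrA -exprMn_comm ?DU ?expr1n ?mul1r //; apply: commr_sym.
by rewrite -{1}(subnK en) exprD -mulrA -exprMn_comm ?UD ?expr1n ?mulr1.
Qed.

Lemma expanding_left (D : M) J (A : nat -> M) :
  (forall e, mge 1 (A e)) -> 1 = \sum_(e < J) A e * D ^+ e -> expanding D.
Proof.
case: J => [|J] A1.
  by rewrite big_ord0 => /eqP; rewrite oner_eq0.
rewrite big_ord_recl expr0 mulr1 => E.
(* Multiplying by the inverse [C] of [1 - A 0] leaves only terms with a positive power of [D]. *)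
have [C [C0 CA _]] := geometric_series (A1 0%N).
pose B e := C * A e.+1.
have B1 e : mge 1 (B e) by rewrite -[1]add0r; apply: mgeM.
have BD : 1 = \sum_(e < J) B e * D ^+ e.+1.
  rewrite -{1}CA {1}E addrAC subrr add0r mulr_sumr.
  by apply: eq_bigr => e _; rewrite mulrA.
pose U := \sum_(e < J) B e * D ^+ e.
have UD : U * D = 1.
  by rewrite mulr_suml BD; apply: eq_bigr => e _; rewrite -mulrA -exprSr.
have DU : D * U = 1 by apply: mulmx1_comm => //; apply: lau_div.
exists U; split=> //; apply: (@powers_vanish U J) => n l Jn Ul.
(* Multiplication by [U ^+ n] turns [D ^+ e.+1] into [U ^+ (n - e.+1)]; here [e < J < n], so the
   subtraction is a true one. *)
rewrite -[U ^+ n]mul1r BD mulr_suml; apply: mge_sum => e _.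
rewrite -mulrA (proj1 (mulUD UD DU _)); last by have := ltn_ord e; lia.
by rewrite addrC; apply: mgeM => //; apply: Ul; rewrite ltnW.
Qed.

(** Mirror image of [expanding_left], in the shape that the dual motive provides. *)
Lemma expanding_right (D : M) J (A : nat -> M) :
  (forall e, mge 1 (A e)) -> 1 = \sum_(e < J) D ^+ e * A e -> expanding D.
Proof.
case: J => [|J] A1.
  by rewrite big_ord0 => /eqP; rewrite oner_eq0.
rewrite big_ord_recl expr0 mul1r => E.
have [C [C0 _ AC]] := geometric_series (A1 0%N).
pose B e := A e.+1 * C.
have B1 e : mge 1 (B e) by rewrite -[1]addr0; apply: mgeM.
have BD : 1 = \sum_(e < J) D ^+ e.+1 * B e.
  rewrite -{1}AC {1}E addrAC subrr add0r mulr_suml.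
  by apply: eq_bigr => e _; rewrite mulrA.
pose U := \sum_(e < J) D ^+ e * B e.
have DU : D * U = 1.
  by rewrite mulr_sumr BD; apply: eq_bigr => e _; rewrite mulrA -exprS.
have UD : U * D = 1 by apply: mulmx1_comm => //; apply: lau_div.
exists U; split=> //; apply: (@powers_vanish U J) => n l Jn Ul.
rewrite -[U ^+ n]mulr1 BD mulr_sumr; apply: mge_sum => e _.
rewrite mulrA (proj2 (mulUD UD DU _)); last by have := ltn_ord e; lia.
by apply: mgeM => //; apply: Ul; rewrite ltnW.
Qed.

End Contraction.

(** * Invariant factors by substituting [t = D] *)

Section InvariantFactors.
Variables (K : fieldType) (T : twisting K) (d : nat).
Local Notation L := (laurent T).
Local Notation M := 'M[L]_d.+1.

Definition pge k (p : {poly M}) := forall i, mge k p`_i.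

Lemma ex_pge (p : {poly M}) : exists k, pge k p.
Proof.
have [|i|k kp] := @uniform_bound 'I_(size p) (fun k i => mge k p`_i).
- by move=> i k k'; apply: mgeW.
- exact: ex_mge.
exists k => i; have [ip|pi] := ltnP i (size p); first exact: (kp (Ordinal ip)).
by rewrite nth_default //; apply: mge0.
Qed.

Lemma pgeM k l (p r : {poly M}) : pge k p -> pge l r -> pge (k + l) (p * r).
Proof. by move=> kp lr i; rewrite coefM; apply: mge_sum => j _; apply: mgeM. Qed.

Lemma pgeC k A : mge k A -> pge k A%:P.
Proof. by move=> kA i; rewrite coefC; case: ifP => // _; apply: mge0. Qed.

Lemma pgeX k (p : {poly M}) n : pge k p -> pge (k *+ n) (p ^+ n).
Proof.
move=> kp; elim: n => [|n IHn]; first by apply: pgeC; apply: mge1.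
by rewrite exprS mulrS; apply: pgeM.
Qed.

Lemma pgeMXn k (p : {poly M}) n : pge k p -> pge k (p * 'X^n).
Proof. by move=> kp i; rewrite coefMXn; case: ifP => // _; apply: mge0. Qed.

Lemma pgeW k k' (p : {poly M}) : k' <= k -> pge k p -> pge k' p.
Proof. by move=> kk' kp i; apply: mgeW (kp i). Qed.

(** A diagonal matrix of polynomials, rewritten as a polynomial with matrix coefficients. *)
Definition pdiag (f : 'I_d.+1 -> {poly L}) : {poly M} :=
  \poly_(k < \max_i size (f i)) \matrix_(i, j) ((f i)`_k *+ (i == j)).

Lemma coef_pdiag f k i j : (pdiag f)`_k i j = (f i)`_k *+ (i == j).
Proof.
rewrite coef_poly; case: ltnP => [_|fk]; rewrite !mxE //.
by rewrite nth_default ?mul0rn //; apply: leq_trans fk; apply: leq_bigmax.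
Qed.

Lemma pdiagM f g : pdiag f * pdiag g = pdiag (fun i => f i * g i).
Proof.
apply/polyP => k; apply/matrixP => i j; rewrite coef_pdiag !coefM summxE -sumrMnl.
apply: eq_bigr => a _; rewrite mxE (bigD1 i) //= big1 => [|l /negPf li].
  by rewrite !coef_pdiag eqxx addr0 mulrnAr.
by rewrite coef_pdiag eq_sym li mul0r.
Qed.

Lemma pge_pdiag k (f : 'I_d.+1 -> {poly L}) : (forall i a, lge k (f i)`_a) -> pge k (pdiag f).
Proof.
by move=> kf a i j; rewrite coef_pdiag; case: (i == j); [exact: kf|exact: lge0].
Qed.

Lemma horner_mulXn (R : nzRingType) (p : {poly R}) n x : (p * 'X^n).[x] = p.[x] * x ^+ n.
Proof.
by elim: n => [|n IHn]; rewrite ?mulr1 // !exprSr !mulrA hornerMX IHn.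
Qed.

(* The matrix polynomials are regarded as elements of [{poly M}], whose evaluation
   at [D] puts the powers of [D] on the right of the coefficients, so that the
   polynomials vanishing at [D] are the left multiples of ['X - D%:P]. *)
Variables (D : M) (P Pi Q Qi : {poly M}) (lam : 'I_d.+1 -> {poly L}).
Hypotheses (PPi : P * Pi = 1) (PiP : Pi * P = 1) (QQi : Q * Qi = 1) (QiQ : Qi * Q = 1).
Hypothesis diagD : P * ('X - D%:P) * Q = pdiag lam.

(** Works for every invariant factor: [lam i] is a right divisor of the diagonal entry [i] of
    [1 - G * 'X^(n.+1)], to which the Gauss lemma applies. *)
Lemma dominant_of_expanding i : expanding D -> dominant_const (lam i).
Proof.
case=> U [UD DU Unil]; have [k kQ] := ex_pge Q; have [l lQi] := ex_pge Qi.
(* The order [|1 - k - l|] outweighs the denominators of [Q] and [Qi]. The exponent [n.+1] is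
   positive, so the constant coefficient stays [1]. *)
have [n /(_ n.+1 (leqnSn n)) Un] := Unil (absz (1 - k - l)%R).
have /factor_theorem[H HE] : root (1 - (U ^+ n.+1)%:P * 'X^(n.+1)) D.
  apply/rootP; rewrite hornerD hornerN horner_mulXn !hornerC.
  by rewrite (proj2 (mulUD UD DU _)) // subnn subrr.
pose G := Qi * (U ^+ n.+1)%:P * Q.
have GE : 1 - G * 'X^(n.+1) = (Qi * H * Pi) * pdiag lam.
  rewrite -diagD !mulrA -[_ * Pi * P]mulrA PiP mulr1.
  rewrite -[Qi * H * _]mulrA -HE mulrBr mulrBl mulr1 QiQ; congr (_ - _).
  by rewrite /G -!mulrA; congr (_ * (_ * _)); rewrite commr_polyXn.
have G1 : pge 1 G.
  apply: (@pgeW (l + absz (1 - k - l)%R + k)); first by lia.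
  by apply/pgeM => //; apply/pgeM => //; apply: pgeC.
pose c := map_poly (fun A : M => A i i) (Qi * H * Pi).
have cE a : c`_a = (Qi * H * Pi)`_a i i by rewrite coef_map_id0 ?mxE.
have clam a : (c * lam i)`_a = (1 - G * 'X^(n.+1))`_a i i.
  rewrite GE !coefM summxE; apply: eq_bigr => b _; rewrite cE mxE.
  rewrite (bigD1 i) //= big1 => [|j /negPf ji]; first by rewrite coef_pdiag eqxx addr0.
  by rewrite coef_pdiag ji mulr0.
apply: (@dominant_const_factor _ _ c) => [|a a0]; rewrite clam coefB coef1.
  by rewrite coefMXn subr0 mxE eqxx.
rewrite (negPf (lt0n_neq0 a0)) sub0r; apply: mgeN; exact: pgeMXn.
Qed.

(** Right divisibility makes the scalar matrix with entry [mu = b * lam i] a left multiple of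
    [diag lam], so one small [beta] serves all diagonal entries. *)
Lemma expanding_of_dominant i :
  (forall j, exists c, lam i = c * lam j) -> dominant_const (lam i) -> expanding D.
Proof.
move=> /fin_all_exists[c cE] [w [lw lw0 lk]].
have [b [bw b_lam _]] := lau_inverse lw lw0.
pose mu := b%:P * lam i.
have mu0 : mu`_0 = 1 by rewrite coefCM.
have muk k : lge 1 mu`_k.+1.
  by rewrite coefCM -[1](addKr w); apply: lgeM => //; apply: lk.
pose beta := pdiag (fun=> \poly_(k < size mu) - mu`_k.+1).
have beta1 : pge 1 beta.
  apply: pge_pdiag => _ a; rewrite coef_poly; case: ifP => _; last exact: lge0.
  exact: lgeN.
pose R := pdiag (fun=> b%:P) * pdiag c * P.
have muE : 1 - beta * 'X = pdiag (fun=> mu).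
  apply/polyP => a; apply/matrixP => j l; rewrite coef_pdiag coefB coefMX coef1.
  rewrite mxE [X in _ + X]mxE.
  case: a => [|a]; first by rewrite mxE mxE oppr0 addr0 mu0.
  rewrite mxE add0r coef_pdiag coef_poly; case: ltnP => [_|sa]; first by rewrite mulNrn opprK.
  by rewrite (@nth_default _ _ mu) ?mul0rn ?oppr0 // ltnW.
have RE : R * ('X - D%:P) = (1 - beta * 'X) * Qi.
  have -> : (1 - beta * 'X) = R * ('X - D%:P) * Q.
    rewrite muE /R -!mulrA [P * _]mulrA diagD !pdiagM; congr pdiag.
    by apply: funext => j; rewrite -cE.
  by rewrite -[RHS]mulrA QQi mulr1.
have [k kQ] := ex_pge Q; have [l lQi] := ex_pge Qi.
(* [beta ^+ m] has order at least [m], enough to outweigh the denominators of [Q] and [Qi]. *)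
pose m := absz (1 - k - l)%R; pose G := Q * beta ^+ m * Qi * 'X^m.
have G1 : pge 1 G.
  apply/pgeMXn/(@pgeW (k + 1 *+ m + l)); first by rewrite -[1 *+ m]/(m%:R) natz; lia.
  by do 2?apply: pgeM => //; apply: pgeX.
have rootG : root (1 - G) D.
  (* The geometric sum times [1 - beta * 'X] telescopes to [1 - (beta * 'X) ^+ m], and conjugation
     by [Q] turns this into [1 - G]. *)
  apply/factor_theorem; exists (Q * (\sum_(a < m) (beta * 'X) ^+ a) * R).
  rewrite -[RHS]mulrA RE mulrA -[Q * _ * _]mulrA.
  have -> : (\sum_(a < m) (beta * 'X) ^+ a) * (1 - beta * 'X) = 1 - (beta * 'X) ^+ m.
    have -> : 1 - (beta * 'X) ^+ m = (1 - beta * 'X) * \sum_(a < m) (beta * 'X) ^+ a.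
      by rewrite -opprB subrX1 -mulNr opprB.
    apply/commr_sym/commr_sum => a _; apply/commrX/commr_sym/commrB => //.
    exact: commr1.
  rewrite mulrBr mulr1 mulrBl QQi /G exprMn_comm; last exact/commr_polyX.
  by congr (_ - _); rewrite -!mulrA; do 2 congr (_ * _); rewrite commr_polyXn.
have GD : 1 = G.[D].
  by move/rootP: rootG; rewrite hornerD hornerN hornerC => /eqP; rewrite subr_eq0 => /eqP.
apply: (@expanding_left _ _ _ _ (size G) (fun e => G`_e)) => //.
by rewrite -horner_coef.
Qed.

End InvariantFactors.

(** * Finite generation of the motives *)

Section SkewPolynomials.
Variables (K : fieldType) (T : twisting K) (q : nat).
Hypothesis TN : forall n x, T (- n%:Z) x = x ^+ (q ^ n).
Local Notation L := (laurent T).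

Lemma emb_bounded (p : {poly K}) :
  exists l : int, forall i : int, i < l -> (if i <= 0 then p`_(absz i) else 0) = 0.
Proof.
exists (- (size p)%:Z) => i ip; case: ifP => // i0.
have : (size p <= absz i)%N by lia.
exact: nth_default.
Qed.
Definition emb (p : {poly K}) : L := Laurent T (emb_bounded p).

Lemma emb_coef (p : {poly K}) n : emb p (- n%:Z) = p`_n.
Proof. by rewrite /= oppr_le0 lez_nat abszN. Qed.

Lemma emb_inj : injective emb.
Proof. by move=> p r pr; apply/polyP => n; rewrite -!emb_coef pr. Qed.

(** The degree in [tau] is minus the order in [sigma]; for [n = 0] this says that only the zero
    polynomial embeds with order at least 1. *)
Lemma lge_emb (p : {poly K}) (n : nat) : (size p <= n)%N <-> lge (1 - n%:Z) (emb p).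
Proof.
split=> [pn i ni|pn]; last first.
  by apply/leq_sizeP => j nj; rewrite -emb_coef pn //; lia.
rewrite /=; case: ifP => // i0; have : (size p <= absz i)%N by lia.
exact: nth_default.
Qed.

Lemma embD p r : emb (p + r) = emb p + emb r.
Proof. by apply: lauP => n /=; case: ifP; rewrite ?coefD ?addr0. Qed.

Lemma emb0 : emb 0 = 0.
Proof. by apply: lauP => n /=; rewrite coef0 if_same. Qed.

Lemma embN p : emb (- p) = - emb p.
Proof. by apply: lauP => n /=; case: ifP; rewrite ?coefN ?oppr0. Qed.

Lemma emb_sum I (s : seq I) (P : pred I) F :
  emb (\sum_(i <- s | P i) F i) = \sum_(i <- s | P i) emb (F i).
Proof. exact: (big_morph _ embD emb0). Qed.

Lemma emb_monomial a n : emb (a *: 'X^n) = lmon T (- n%:Z) a.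
Proof.
apply: lauP => i /=; rewrite coefZ coefXn; case: (i == _) /eqP => [->|ni].
  by rewrite oppr_le0 abszN eqxx mulr1.
case: ifP => // i0; have [E|] := eqVneq; last by rewrite mulr0.
by case: ni; rewrite -E; lia.
Qed.

Lemma embC a : emb a%:P = lmon T 0 a.
Proof. by rewrite -alg_polyC -(expr0 'X) emb_monomial oppr0. Qed.

Lemma embM (p r : {poly K}) : emb (skmul q p r) = emb p * emb r.
Proof.
have F0 i n : (0 < i) || (i < n) -> emb p i * T i (emb r (n - i)) = 0.
  case/orP=> [i0|ni]; first by rewrite /= leNgt i0 mul0r.
  by rewrite [X in T i X]/= ifF ?rmorph0 ?mulr0 //; lia.
have sF0 i n : (i <= - (size p)%:Z) || (n + (size r)%:Z <= i) ->
    emb p i * T i (emb r (n - i)) = 0.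
  case/orP=> ni; first by rewrite ((lge_emb p (size p)).1 (leqnn _)) ?mul0r //; lia.
  by rewrite [emb r _]((lge_emb r (size r)).1 (leqnn _)) ?rmorph0 ?mulr0 //; lia.
apply: lauP => n.
have -> : (emb p * emb r) n =
    wsum n (absz (- n)).+1 (fun i => emb p i * T i (emb r (n - i))).
  have [k [kp kr]] := ex_lge2 (emb p) (emb r).
  pose l := Order.min k (Order.min n 0).
  rewrite (@lmulE _ _ k k _ _ l (absz (Order.max (n - k) 0 - l)%R).+1) //; try lia.
  have [n0|n0] := ltP 0 n.
    by rewrite !wsum0 // => i; apply: F0; lia.
  by apply: wsum_widen; try lia; move=> i Hi; apply: F0; lia.
have [n0|n0] := ltP 0 n.
  by rewrite wsum0 => [|i]; [rewrite /= leNgt n0|apply: F0; lia].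
have [k ->] : exists k : nat, n = - k%:Z by exists (absz n); lia.
(* The window from [-k] to [0] is reversed, so that its index becomes the exponent of [tau] in the
   first factor of [skmul]. *)
rewrite emb_coef coef_poly opprK absz_nat /wsum [RHS](reindex_inj rev_ord_inj).
have E (i : 'I_k.+1) : - k%:Z + (rev_ord i : nat)%:Z = - (i : nat)%:Z.
  by rewrite /=; have := ltn_ord i; lia.
(* From the cut-off [size p + size r] of [skmul] on, all terms of the convolution vanish. *)
case: ltnP => [_|sk]; last rewrite big1 // => i _.
  apply: eq_bigr => i _; rewrite E emb_coef TN.
  have -> : - k%:Z - - (i : nat)%:Z = - (k - i)%N%:Z by have := ltn_ord i; lia.
  by rewrite emb_coef.
rewrite E; apply: sF0; have {}sk : (size p + size r <= k)%N := sk; have := ltn_ord i; lia.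
Qed.

(** Cutting off the positive orders gives an integral part; the second clause says that this does
    not raise the degree. *)
Lemma emb_polynomial_part (x : L) : exists p, lge 1 (x - emb p) /\
  forall n : nat, lge (1 - n%:Z) x -> lge (1 - n%:Z) (emb p).
Proof.
have [k kx] := ex_lge x; pose p := \poly_(i < (absz k).+1) x (- i%:Z).
have pE i : i <= 0 -> emb p i = x i.
  move=> i0; rewrite /= i0 coef_poly; case: ltnP => ik; first by congr (x _); lia.
  by rewrite kx //; lia.
exists p; split=> [i i1|n nx i ni].
  by rewrite /= -[if _ then _ else _]/(emb p i) pE ?subrr //; lia.
have [i0|i0] := leP i 0; first by rewrite pE ?nx.
by rewrite /= leNgt i0.
Qed.

Definition embm m n (A : 'M[{poly K}]_(m, n)) : 'M[L]_(m, n) := map_mx emb A.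

Lemma embm_inj m n : injective (@embm m n).
Proof.
move=> A B /matrixP AB; apply/matrixP => i j; apply: emb_inj.
by have := AB i j; rewrite !mxE.
Qed.

Lemma embmM m n p (A : 'M_(m, n)) (B : 'M_(n, p)) :
  embm (mxskmul q A B) = embm A *m embm B.
Proof.
apply/matrixP => i j; rewrite !mxE emb_sum; apply: eq_bigr => k _.
by rewrite embM !mxE.
Qed.

Lemma embm_scalar n a : embm (a%:P%:M : 'M_n) = (lmon T 0 a)%:M.
Proof.
by apply/matrixP => i j; rewrite !mxE; case: (i == j); rewrite ?emb0 // embC.
Qed.

Lemma embmD m n (A B : 'M_(m, n)) : embm (A + B) = embm A + embm B.
Proof. by apply/matrixP => i j; rewrite !mxE embD. Qed.

Lemma embmN m n (A : 'M_(m, n)) : embm (- A) = - embm A.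
Proof. by apply/matrixP => i j; rewrite !mxE embN. Qed.

Lemma embm0 m n : embm (0 : 'M_(m, n)) = 0.
Proof. by apply/matrixP => i j; rewrite !mxE emb0. Qed.

Lemma embm_sum m n I (s : seq I) (P : pred I) (F : I -> 'M_(m, n)) :
  embm (\sum_(i <- s | P i) F i) = \sum_(i <- s | P i) embm (F i).
Proof. exact: (big_morph _ (@embmD m n) (@embm0 m n)). Qed.

Lemma embmX d (D : 'M_d.+1) e : embm (mxskpow q D e) = embm D ^+ e.
Proof.
elim: e => [|e IHe]; first exact: (embm_scalar _ 1).
by rewrite exprS -IHe /mxskpow /= embmM.
Qed.

Lemma embmZ m n a (A : 'M_(m, n)) : embm (a%:P *: A) = lmon T 0 a *: embm A.
Proof.
apply/matrixP => i j; rewrite !mxE; apply: lauP => k.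
rewrite lmul_lmonl subr0 tw0 /= mul_polyC coefZ.
by case: ifP; rewrite ?mulr0.
Qed.

Lemma embm_polynomial_part m n (A : 'M[L]_(m, n)) : exists B, mge 1 (A - embm B) /\
  forall k : nat, mge (1 - k%:Z) A -> mge (1 - k%:Z) (embm B).
Proof.
have /choice[f fP] i : exists g : 'I_n -> {poly K}, forall j, lge 1 (A i j - emb (g j)) /\
    forall k : nat, lge (1 - k%:Z) (A i j) -> lge (1 - k%:Z) (emb (g j)).
  by have /choice[g gP] j := emb_polynomial_part (A i j); exists g.
exists (\matrix_(i, j) f i j); split=> [i j|k Ak i j]; rewrite !mxE.
  by case: (fP i j).
by apply: (fP i j).2.
Qed.

End SkewPolynomials.

Lemma big_ord_pad (V : nmodType) J N (F : nat -> V) : (J <= N)%N ->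
  \sum_(e < J) F e = \sum_(e < N) (if (e < J)%N then F e else 0).
Proof. by move=> JN; rewrite (big_ord_widen N F JN) big_mkcond. Qed.

(** * Finite generation from division with remainder *)

Section FiniteSpan.
Variables (V : zmodType) (K : nmodType) (I : finType) (x0 : I) (G : I -> V).
Variables (Tp : nat -> V -> V) (s : K -> V -> V) (n : nat) (P : nat -> V -> Prop).
Hypotheses (TpD : forall e, {morph Tp e : x y / x + y}) (Tp_0 : forall e, Tp e 0 = 0)
  (Tp0 : Tp 0 =1 id) (TpM : forall e f x, Tp e (Tp f x) = Tp (e + f)%N x)
  (s0 : forall x, s 0 x = 0) (sD : forall a b x, s (a + b) x = s a x + s b x)
  (P0 : forall m, P 0 m -> m = 0)
  (PS : forall N m, P N.+1 m -> exists m' (c : I -> K),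
     P N m' /\ m = Tp n m' + \sum_x s (c x) (G x)).

(* [P N] stands for having degree below [N], and [PS] is a division with remainder
   in the span of the generators [G]. *)
Lemma finite_span N m : P N m -> exists J (c : nat -> nat -> K),
  let X := [seq G x | x <- enum I] in
  m = \sum_(g < size X) \sum_(e < J) Tp e (s (c g e) (nth 0 X g)).
Proof.
suff: P N m -> exists J (c : I -> nat -> K), m = \sum_x \sum_(e < J) Tp e (s (c x e) (G x)).
  move=> H /H[J [c ->]]; exists J, (fun g => c (nth x0 (enum I) g)) => X.
  rewrite -big_enum [enum _](_ : _ = enum I) // (big_nth x0) big_mkord /X size_map.
  apply: eq_bigr => g _.
  by apply: eq_bigr => e _; rewrite (nth_map x0 0 G) ?ltn_ord.
elim: N m => [|N IHN] m.
  move=> /P0->; exists 0%N, (fun _ _ => 0); rewrite big1 // => x _.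
  by rewrite big_ord0.
(* The coefficients of the quotient move up by [n], those of the remainder sit at exponent [0]. They
   are added, since they may overlap if [n = 0]; the successor in the length keeps exponent [0]
   available. *)
case/PS => m' [c [/IHN[J [c' ->]] ->]]; exists (n + J).+1.
pose a x e := if (n <= e < n + J)%N then c' x (e - n)%N else 0.
pose b x e := if e == 0%N then c x else 0.
exists (fun x e => a x e + b x e).
rewrite (big_morph (Tp n) (TpD n) (Tp_0 n)) -big_split; apply: eq_bigr => x _ /=.
under [RHS]eq_bigr do rewrite sD TpD.
rewrite big_split; congr (_ + _) => /=; last first.
  rewrite big_ord_recl /b /= Tp0 big1 ?addr0 // => e _.
  by rewrite /= s0 Tp_0.
rewrite big_ord_recr /= [a x (n + J)%N]ifF ?s0 ?Tp_0 ?addr0; last by lia.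
rewrite big_split_ord /= [X in _ = X + _]big1 ?add0r => [|e _]; last first.
  by rewrite [a x e]ifF ?s0 ?Tp_0 //; have := ltn_ord e; lia.
rewrite (big_morph (Tp n) (TpD n) (Tp_0 n)); apply: eq_bigr => e _.
by rewrite TpM /a leq_addr ltn_add2l ltn_ord addKn.
Qed.

End FiniteSpan.

(** * The two motives of an expanding matrix *)

Section Motives.
Variables (K : fieldType) (T : twisting K) (q : nat).
Hypothesis TN : forall n x, T (- n%:Z) x = x ^+ (q ^ n).
Local Notation L := (laurent T).
Variables (d : nat) (D : 'M[{poly K}]_d.+1).
Local Notation DL := (embm T D).

Lemma expanding_of_abelian : tmod_abelian q D -> expanding DL.
Proof.
case=> gens genP; pose g i := embm T (nth 0 gens i).
have [|i|k gk] := @uniform_bound 'I_(size gens) (fun k i => mge k (g i)).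
- by move=> i k k'; apply: mgeW.
- exact: ex_mge.
(* With this [s], division by [tau^s] brings every generator to order at least [s + k >= 1]. *)
pose s := absz (1 - k)%R.
have /choice[N /choice[c cP]] r := genP (\row_j ('X^s *+ (j == r))).
pose J := (\max_r N r)%N.
pose a r i e : L := if (e < N r)%N then lmon T 0 (c r i e) else 0.
have a0 r i e : lge 0 (a r i e).
  by rewrite /a; case: ifP => _; [apply: lge_lmon|apply: lge0].
(* This is row [r] of the coefficient of [D^e], obtained from the expression of [tau^s e_r] by
   multiplying with [sigma^s] on the left. *)
pose V e r := lmon T s%:Z 1 *: \sum_(i < size gens) a r i e *: g i.
apply: (@expanding_left _ _ _ _ J (fun e => \matrix_(r, j) V e r 0 j)).
  move=> e r j; rewrite !mxE; apply: (@lgeW _ _ (s%:Z + (0 + k))); first by lia.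
  apply: lgeM; first exact: lge_lmon.
  by rewrite summxE; apply: lge_sum => i _; rewrite mxE; apply: lgeM => //; apply: gk.
apply/row_matrixP => r; rewrite linear_sum /=.
have VE e : row r (\matrix_(r, j) V e r 0 j) = V e r.
  by apply/rowP => j; rewrite !mxE.
have -> : row r (1 : 'M[L]_d.+1) =
    lmon T s%:Z 1 *: embm T (\row_j ('X^s *+ (j == r))).
  apply/rowP => j; rewrite !mxE eq_sym; case: (j == r); last by rewrite emb0 mulr0.
  by rewrite -['X^s]scale1r emb_monomial lmonM subrr mul1r [T _ 1]rmorph1 lmon1.
rewrite cP embm_sum.
under [RHS]eq_bigr do rewrite row_mul VE -scalemxAl mulmx_suml.
rewrite -scaler_sumr exchange_big /=; congr (_ *: _); apply: eq_bigr => i _.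
have NJ : (N r <= J)%N by apply: leq_bigmax.
rewrite embm_sum (@big_ord_pad _ _ _ (fun e => embm T
  ((c r i e)%:P *: mxskmul q (nth 0 gens i) (mxskpow q D e))) NJ); apply: eq_bigr => e _.
rewrite /a; case: ifP => _; last by rewrite scale0r mul0mx.
by rewrite embmZ (embmM TN) (embmX TN) -scalemxAl.
Qed.

Lemma expanding_of_tfinite : tmod_tfinite q D -> expanding DL.
Proof.
case=> gens genP; pose g i := embm T (nth 0 gens i).
have [|i|k gk] := @uniform_bound 'I_(size gens) (fun k i => mge k (g i)).
- by move=> i k k'; apply: mgeW.
- exact: ex_mge.
pose s := absz (1 - k)%R.
have /choice[N /choice[c cP]] r := genP (\col_j ('X^s *+ (j == r))).
pose J := (\max_r N r)%N.
pose a r i e : L := if (e < N r)%N then lmon T 0 (c r i e) else 0.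
have a0 r i e : lge 0 (a r i e).
  by rewrite /a; case: ifP => _; [apply: lge_lmon|apply: lge0].
(* On columns the scalars act on the right, so they and [sigma^s] enter as 1 by 1 matrices there,
   and the powers of [D] stay on the left. *)
pose V e r := (\sum_(i < size gens) g i *m (a r i e)%:M) *m (lmon T s%:Z 1)%:M.
apply: (@expanding_right _ _ _ _ J (fun e => \matrix_(j, r) V e r j 0)).
  move=> e j r; rewrite mxE; apply: (@lgeW _ _ (k + 0 + s%:Z)); first by lia.
  apply: mge_mulmx; last exact/mge_scalar/lge_lmon.
  apply: mge_sum => i _; apply: mge_mulmx; [exact: gk|exact: mge_scalar].
apply/matrixP => j r; rewrite summxE.
have -> : (1 : 'M[L]_d.+1) j r =
    (embm T (\col_j ('X^s *+ (j == r))) *m (lmon T s%:Z 1)%:M) j 0.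
  rewrite !mxE big_ord1 !mxE; case: (j == r); last by rewrite emb0 mul0r.
  by rewrite -['X^s]scale1r emb_monomial lmonM addNr mul1r [T _ 1]rmorph1 lmon1.
have VE e : (DL ^+ e * \matrix_(j, r) V e r j 0) j r = (DL ^+ e *m V e r) j 0.
  by rewrite !mxE; apply: eq_bigr => l _; rewrite !mxE.
under [RHS]eq_bigr do rewrite VE.
rewrite -summxE; congr ((_ : 'cV_d.+1) j 0).
under [RHS]eq_bigr do rewrite /V mulmxA mulmx_sumr.
rewrite -mulmx_suml exchange_big cP embm_sum; congr (_ *m _).
apply: eq_bigr => i _.
have NJ : (N r <= J)%N by apply: leq_bigmax.
rewrite embm_sum (@big_ord_pad _ _ _ (fun e => embm T
  (mxskmul q (mxskpow q D e) (mxskmul q (nth 0 gens i) ((c r i e)%:P)%:M))) NJ).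
apply: eq_bigr => e _.
rewrite /a; case: ifP => _; last by rewrite raddf0 !mulmx0.
by rewrite !(embmM TN) (embmX TN) embm_scalar.
Qed.

(** Fixes the divisor for the Euclidean division: a power of [D] whose inverse has positive
    order. *)
Lemma expanding_pow : expanding DL -> exists n U, [/\ mge 1 U, U * DL ^+ n = 1 & DL ^+ n * U = 1].
Proof.
case=> U [UD DU /(_ 1%N)[n /(_ n (leqnn n)) Un]]; exists n, (U ^+ n).
by have [-> ->] := mulUD UD DU (leqnn n); rewrite subnn.
Qed.

Lemma abelian_of_expanding : expanding DL -> tmod_abelian q D.
Proof.
move=> /expanding_pow[n [U [U1 UD _]]]; have [k Dk] := ex_mge (DL ^+ n).
(* Remainders will have order at least [1 + k], hence degree at most [C]; the generators are the
   vectors [tau^i e_r] with [i <= C]. *)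
pose C := absz k.
pose G (x : 'I_d.+1 * 'I_C.+1) : 'rV[{poly K}]_d.+1 := \row_j ('X^(x.2) *+ (j == x.1)).
pose P N (m : 'rV[{poly K}]_d.+1) := mge (1 - N%:Z) (embm T m).
pose Tp e m : 'rV[{poly K}]_d.+1 := mxskmul q m (mxskpow q D e).
exists [seq G x | x <- enum {: 'I_d.+1 * 'I_C.+1}] => m.
have [N mN] : exists N, P N m.
  have [l lm] := ex_mge (embm T m); exists (absz (1 - l)%R).
  by apply: mgeW lm; lia.
have TpE e x : embm T (Tp e x) = embm T x *m DL ^+ e by rewrite (embmM TN) (embmX TN).
have [||||||||J [c ->]] := @finite_span _ _ _ (ord0, ord0) G Tp (fun c x => c%:P *: x) n P
   _ _ _ _ _ _ _ _ N m mN.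
- by move=> e x y; apply: (@embm_inj _ T); rewrite !(TpE, embmD) mulmxDl.
- by move=> e; apply: (@embm_inj _ T); rewrite TpE embm0 mul0mx.
- by move=> x; apply: (@embm_inj _ T); rewrite TpE mulmx1.
- by move=> e f x; apply: (@embm_inj _ T); rewrite !TpE -mulmxA addnC exprD.
- by move=> x; rewrite scale0r.
- by move=> a b x; rewrite polyCD scalerDl.
- move=> x x0; apply/matrixP => i j; rewrite [RHS]mxE; apply/eqP.
  by rewrite -size_poly_leq0; apply/(lge_emb T); have := x0 i j; rewrite mxE.
(* The quotient by [D^n] is the polynomial part of [x U]; as [U] has order at least 1, the degree
   bound drops from [N'.+1] to [N']. *)
- move=> N' x xN; pose y := embm T x *m U.
  have [x' [x'1 x'N]] := embm_polynomial_part y.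
  pose z := x - Tp n x'.
  (* As [y D^n = x], the remainder is the fractional part of [y] times [D^n]. *)
  have zC i j : (size (z i j) <= C.+1)%N.
    apply/(lge_emb T); have -> : emb T (z i j) = ((y - embm T x') *m DL ^+ n) i j.
      by rewrite mulmxBl -mulmxA [U *m _]UD mulmx1 -TpE -embmN -embmD [RHS]mxE.
    by apply: (@lgeW _ _ (1 + k)); [lia|apply: mge_mulmx].
  exists x', (fun t : 'I_d.+1 * 'I_C.+1 => (z 0 t.1)`_t.2); split.
    apply: x'N; apply: (@mgeW _ _ (1 - N'.+1%:Z + 1)); first by lia.
    exact: mge_mulmx.
  rewrite -[LHS](subrK (Tp n x')) -/z addrC; congr (_ + _).
  apply/rowP => j; rewrite summxE.
  rewrite (eq_bigr (fun t : 'I_d.+1 * 'I_C.+1 => ((z 0 t.1)`_t.2 *: 'X^(t.2)) *+ (j == t.1))).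
    rewrite -(pair_big predT predT (fun r (i : 'I_C.+1) => ((z 0 r)`_i *: 'X^i) *+ (j == r))) /=.
    rewrite (bigD1 j) //= [X in _ + X]big1 ?addr0 => [|r /negPf rj]; last first.
      by rewrite big1 // => i _; rewrite eq_sym rj.
    under eq_bigr do rewrite eqxx.
    rewrite -(poly_def _ (fun i => (z 0 j)`_i)); apply/polyP => i; rewrite coef_poly.
    by case: ltnP => // Ci; rewrite nth_default //; apply: leq_trans (zC _ _) Ci.
  by move=> t _; rewrite !mxE mulrnAr mul_polyC.
by exists J, c; apply: eq_bigr => i _; apply: eq_bigr => e _;
   apply: (@embm_inj _ T); rewrite TpE !embmZ (embmM TN) (embmX TN) scalemxAl.
Qed.

Lemma tfinite_of_expanding : expanding DL -> tmod_tfinite q D.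
Proof.
move=> /expanding_pow[n [U [U1 _ DU]]]; have [k Dk] := ex_mge (DL ^+ n).
pose C := absz k.
pose G (x : 'I_d.+1 * 'I_C.+1) : 'cV[{poly K}]_d.+1 := \col_j ('X^(x.2) *+ (j == x.1)).
pose P N (m : 'cV[{poly K}]_d.+1) := mge (1 - N%:Z) (embm T m).
pose Tp e m : 'cV[{poly K}]_d.+1 := mxskmul q (mxskpow q D e) m.
pose s c (x : 'cV[{poly K}]_d.+1) : 'cV[{poly K}]_d.+1 := mxskmul q x (c%:P)%:M.
exists [seq G x | x <- enum {: 'I_d.+1 * 'I_C.+1}] => m.
have [N mN] : exists N, P N m.
  have [l lm] := ex_mge (embm T m); exists (absz (1 - l)%R).
  by apply: mgeW lm; lia.
have TpE e x : embm T (Tp e x) = DL ^+ e *m embm T x by rewrite (embmM TN) (embmX TN).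
have sE a x : embm T (s a x) = embm T x *m (lmon T 0 a)%:M.
  by rewrite (embmM TN) embm_scalar.
have lmonD a b : lmon T 0 (a + b) = lmon T 0 a + lmon T 0 b.
  by rewrite -!embC polyCD embD.
have lmon0 : lmon T 0 0 = 0 by rewrite -embC emb0.
have [||||||||J [c ->]] := @finite_span _ _ _ (ord0, ord0) G Tp s n P
   _ _ _ _ _ _ _ _ N m mN.
- by move=> e x y; apply: (@embm_inj _ T); rewrite !(TpE, embmD) mulmxDr.
- by move=> e; apply: (@embm_inj _ T); rewrite TpE embm0 mulmx0.
- by move=> x; apply: (@embm_inj _ T); rewrite TpE mul1mx.
- by move=> e f x; apply: (@embm_inj _ T); rewrite !TpE mulmxA exprD.
- by move=> x; apply: (@embm_inj _ T); rewrite sE lmon0 raddf0 mulmx0 embm0.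
- by move=> a b x; apply: (@embm_inj _ T); rewrite !(sE, embmD) lmonD raddfD mulmxDr.
- move=> x x0; apply/matrixP => i j; rewrite [RHS]mxE; apply/eqP.
  by rewrite -size_poly_leq0; apply/(lge_emb T); have := x0 i j; rewrite mxE.
- move=> N' x xN; pose y := U *m embm T x.
  have [x' [x'1 x'N]] := embm_polynomial_part y.
  pose z := x - Tp n x'.
  have zC i j : (size (z i j) <= C.+1)%N.
    apply/(lge_emb T); have -> : emb T (z i j) = (DL ^+ n *m (y - embm T x')) i j.
      by rewrite mulmxBr mulmxA [_ *m U]DU mul1mx -TpE -embmN -embmD [RHS]mxE.
    by apply: (@lgeW _ _ (k + 1)); [lia|apply: mge_mulmx].
  (* Since [tau^i c = c^(q^i) tau^i], a right scalar [c] produces the coefficient [z_i] exactly when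
     it is its [q^i]-th root [T i z_i]. *)
  exists x', (fun t : 'I_d.+1 * 'I_C.+1 => T (t.2 : nat)%:Z (z t.1 0)`_t.2); split.
    apply: x'N; apply: (@mgeW _ _ (1 + (1 - N'.+1%:Z))); first by lia.
    exact: mge_mulmx.
  rewrite -[LHS](subrK (Tp n x')) -/z addrC; congr (_ + _).
  apply/colP => j; rewrite summxE.
  rewrite (eq_bigr (fun t : 'I_d.+1 * 'I_C.+1 => ((z t.1 0)`_t.2 *: 'X^(t.2)) *+ (j == t.1))).
    rewrite -(pair_big predT predT (fun r (i : 'I_C.+1) => ((z r 0)`_i *: 'X^i) *+ (j == r))) /=.
    rewrite (bigD1 j) //= [X in _ + X]big1 ?addr0 => [|r /negPf rj]; last first.
      by rewrite big1 // => i _; rewrite eq_sym rj.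
    under eq_bigr do rewrite eqxx.
    rewrite -(poly_def _ (fun i => (z j 0)`_i)); apply/polyP => i; rewrite coef_poly.
    by case: ltnP => // Ci; rewrite nth_default //; apply: leq_trans (zC _ _) Ci.
  move=> t _; apply: (@emb_inj _ T); move: (z t.1 0)`_t.2 => a.
  transitivity (embm T (s (T (t.2 : nat)%:Z a) (G t)) j 0); first by rewrite [RHS]mxE.
  rewrite sE mxE big_ord1 !mxE eqxx mulr1n.
  case: (j == t.1); last by rewrite emb0 mul0r.
  rewrite -['X^_]scale1r !emb_monomial lmonM mul1r addr0 -twD addNr tw0.
  by rewrite scale1r mulr1n emb_monomial.
by exists J, c.
Qed.

End Motives.

(** * Translation of the coefficient-function encoding *)

Section FrobeniusTwist.
Variables (K : fieldType) (q : nat).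
Hypotheses (q_gt0 : (0 < q)%N) (qB : forall x y : K, (x - y) ^+ q = x ^+ q - y ^+ q)
  (q_surj : forall x : K, exists y, y ^+ q = x).

Lemma frobinvK (x : K) : (frobinv q x) ^+ q = x.
Proof. exact: ClassicalEpsilon.epsilon_spec (q_surj x). Qed.

Lemma frob_inj (x y : K) : x ^+ q = y ^+ q -> x = y.
Proof.
move=> xy; apply/eqP; rewrite -subr_eq0.
by have := qB x y; rewrite xy subrr => /eqP; rewrite expf_eq0 q_gt0.
Qed.

Lemma frobK (x : K) : frobinv q (x ^+ q) = x.
Proof. by apply: frob_inj; rewrite frobinvK. Qed.

(** A single recursion across the case split of [twist] at zero; the other laws follow from it by
    induction over the integers. *)
Lemma twistS i (x : K) : twist q (i + 1) x = frobinv q (twist q i x).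
Proof.
case: i => n; first by rewrite -PoszD addn1.
case: n => [|n]; first by rewrite [_ + 1](_ : _ = 0) //= expn1 frobK.
have -> : Negz n.+1 + 1 = Negz n by lia.
by rewrite /= [in RHS]expnSr exprM frobK.
Qed.

Lemma twistP i (x : K) : twist q (i - 1) x = (twist q i x) ^+ q.
Proof. by rewrite -[i in RHS](subrK 1) twistS frobinvK. Qed.

Lemma twistD i j (x : K) : twist q (i + j) x = twist q i (twist q j x).
Proof.
elim/int_rect: i => [|n IHn|n IHn]; first by rewrite add0r.
  by rewrite -addn1 PoszD addrAC !twistS IHn.
by rewrite -addn1 PoszD opprD addrAC !twistP IHn.
Qed.

(** For increasing [i] the identities are checked after applying the injective Frobenius, which
    undoes [frobinv]. *)
Lemma twist_rmorphism i : zmod_morphism (@twist K q i) /\ monoid_morphism (@twist K q i).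
Proof.
elim/int_rect: i => [|n [IHB [IH1 IHM]]|n [IHB [IH1 IHM]]]; first by [].
  rewrite -addn1 PoszD; split; [|split]; move=> *; rewrite !twistS; apply: frob_inj.
  - by rewrite qB !frobinvK IHB.
  - by rewrite frobinvK expr1n.
  - by rewrite exprMn !frobinvK IHM.
rewrite -addn1 PoszD opprD; split; [|split]; move=> *; rewrite !twistP.
- by rewrite IHB qB.
- by rewrite IH1 expr1n.
- by rewrite IHM exprMn.
Qed.

Definition frobenius_rmorphism (i : int) : {rmorphism K -> K} :=
  HB.pack (@twist K q i)
    (GRing.isZmodMorphism.Build _ _ _ (twist_rmorphism i).1)
    (GRing.isMonoidMorphism.Build _ _ _ (twist_rmorphism i).2).

Definition frobenius_twisting : twisting K :=
  @Twisting K frobenius_rmorphism (fun=> erefl) twistD.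

Local Notation T := frobenius_twisting.

Lemma frobenius_twistingN n x : T (- n%:Z) x = x ^+ (q ^ n).
Proof. by case: n => [|n]; rewrite // ?expr1. Qed.

(** * Coefficient functions as polynomials over Laurent series *)

Local Notation L := (laurent T).

(** Formulated for sequences of series, so as to cover both polynomials and a single entry of a
    polynomial with matrix coefficients. *)
Definition lp_rep (f : lp K) (p : nat -> L) := forall k n, f k n = p k n.

Lemma lpbounded_rep l (f : lp K) : lpbounded l f ->
  exists p : {poly L}, lp_rep f (nth 0 p) /\ forall k, lge l p`_k.
Proof.
case=> N fN.
have fb k : exists l : int, forall i : int, i < l -> f k i = 0.
  by exists l => i il; apply: fN; right.
exists (\poly_(k < N) Laurent T (fb k)); split=> [k n|k n nl]; rewrite coef_poly; case: ltnP => //.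
  by move=> Nk; rewrite fN //; left.
by move=> _; apply: fN; right.
Qed.

Lemma lpmul_rep l1 l2 f g (x y : nat -> L) : lp_rep f x -> lp_rep g y ->
  (forall k, lge l1 (x k)) -> (forall k, lge l2 (y k)) ->
  lp_rep (lpmul q l1 l2 f g) (fun k => \sum_(a < k.+1) x a * y (k - a)%N).
Proof.
move=> fx gy lx ly k n; rewrite /lpmul lau_sumE; case: leP => ln; last first.
  by rewrite big1 // => a _; apply: (lgeM (lx a) (ly (k - a)%N)).
apply: eq_bigr => a _.
rewrite (@lmulE _ _ l1 l2 _ _ l1 (absz (n - l1 - l2)%R).+1) //; last lia.
by apply: eq_bigr => r _; rewrite fx gy.
Qed.

Lemma lpmul_poly l1 l2 f g (x y : {poly L}) : lp_rep f (nth 0 x) -> lp_rep g (nth 0 y) ->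
  (forall k, lge l1 x`_k) -> (forall k, lge l2 y`_k) ->
  lp_rep (lpmul q l1 l2 f g) (nth 0 (x * y)).
Proof.
by move=> fx gy lx ly k n; rewrite (lpmul_rep fx gy) // coefM.
Qed.

Lemma lp_rep_inj (f : lp K) (x y : {poly L}) : lp_rep f (nth 0 x) -> lp_rep f (nth 0 y) -> x = y.
Proof. by move=> fx fy; apply/polyP => k; apply: lauP => n; rewrite -fx fy. Qed.

(** By convexity the slopes increase, so everything is decided by the first edge, which starts at
    the constant coefficient. *)
Lemma np_pos_slopesE l (f : lp K) (p : {poly L}) : lpbounded l f -> lp_rep f (nth 0 p) ->
  np_pos_slopes f <-> dominant_const p.
Proof.
move=> [N fN] fp.
have svalE k w : sval_is (f k) w <-> lge w p`_k /\ p`_k w != 0.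
  rewrite /sval_is fp; split=> [[? H]|[H ?]]; split=> // i iw; first by rewrite -fp H.
  by rewrite fp H.
have sval_uniq k v w : sval_is (f k) v -> sval_is (f k) w -> v = w.
  move=> [v0 vk] [w0 wk]; case: (ltgtP v w) => // H; first by rewrite wk ?eqxx in v0.
  by rewrite vk ?eqxx in w0.
split=> [[[i0 f0] pos]|[w [lw pw lk]]]; last first.
  have sw : sval_is (f 0%N) w by apply/svalE.
  have gtw k v : (0 < k)%N -> sval_is (f k) v -> w < v.
    by move=> k0 /svalE[_]; apply: contra_neqT; rewrite -leNgt => vw; apply: lk => //; lia.
  split; first by exists w; rewrite fp.
  move=> i j wi wj ij fi fj H.
  have [i0|i0] := posnP i; last first.
    (* The point [(0, w)] has [w < wi] and lies on or above the line, which forces the line to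
       rise. *)
    by have := gtw _ _ i0 fi; have := H 0%N w sw; nia.
  by rewrite i0 in fi; rewrite (sval_uniq _ _ _ fi sw) (gtw j) //; lia.
have : p`_0 != 0 by apply: contra_neq f0 => p0; rewrite fp p0.
case/lval_ex => w [lw pw]; exists w; split=> //.
have sw : sval_is (f 0%N) w by apply/svalE.
have /choice[v vP] k : exists v, p`_k != 0 -> sval_is (f k) v.
  have [p0|/lval_ex[v vk]] := eqVneq p`_k 0; first by exists 0 => /eqP[].
  by exists v => _; apply/svalE.
have slope k : (0 < k)%N -> p`_k != 0 -> w < v k.
  move=> k0 pk.
  have nz m : p`_m != 0 -> (m < size p)%N.
    by move=> pm; rewrite ltnNge; apply: contra_neqN pm => pm; apply: nth_default.
  (* The smallest slope [F] from [(0, w)] to a point further right belongs to the first edge of the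
     hull; if it is positive, so are all the others. *)
  pose P (m : 'I_(size p)) := (0 < m)%N && (p`_m != 0).
  pose F (m : 'I_(size p)) : rat := (v m - w)%:~R / (m : nat)%:R.
  have Pk : P (Ordinal (nz k pk)) by rewrite /P k0 pk.
  case: (Order.TotalTheory.arg_minP F Pk) => m /andP[m0 pm] mmin.
  have wm : w < v m.
    apply: (pos 0%N m w (v m) m0 sw (vP _ pm)) => j wj fj.
    have [j0|j0] := posnP j; first by rewrite j0 in fj *;
      rewrite (sval_uniq _ _ _ fj sw) !subrr mulr0 mul0r.
    have pj : p`_j != 0 by case/svalE: fj => _; apply: contra_neq => ->.
    (* Minimality of [F], cleared of denominators, says that the point at [j] lies on or above the
       chosen line. *)
    rewrite !subr0; have := mmin (Ordinal (nz j pj)); rewrite /P /= j0 pj => /(_ isT).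
    rewrite /F /= ler_pdivrMr ?ltr0n // mulrAC ler_pdivlMr ?ltr0n //.
    rewrite -[j%:R]/(j%:Z%:~R) -[(m : nat)%:R]/((m : nat)%:Z%:~R) -!rmorphM.
    by rewrite ler_int (sval_uniq _ _ _ fj (vP _ pj)).
  have := mmin _ Pk; rewrite /F /= => Fk.
  have : 0 < (v m - w)%:~R / (m : nat)%:R :> rat by rewrite divr_gt0 ?ltr0n // ltr0z subr_gt0.
  by move/lt_le_trans/(_ Fk); rewrite pmulr_lgt0 ?invr_gt0 ?ltr0n // ltr0z subr_gt0.
move=> k k0; have [->|pk] := eqVneq p`_k 0; first exact: lge0.
have /svalE[lv _] := vP _ pk.
by apply: lgeW lv; have := slope k k0 pk; lia.
Qed.

(** * Matrices of coefficient functions and the invariant factors *)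

Section Matrices.
Variable d : nat.
Local Notation M := 'M[L]_d.+1.

Definition lpmx_rep (A : 'I_d.+1 -> 'I_d.+1 -> lp K) (P : {poly M}) :=
  forall i j k n, A i j k n = P`_k i j n.

Lemma lpmx_rep_inj A P Q : lpmx_rep A P -> lpmx_rep A Q -> P = Q.
Proof.
move=> AP AQ; apply/polyP => k; apply/matrixP => i j; apply: lauP => n.
by rewrite -AP AQ.
Qed.

Lemma lpmx_bounded_rep l A : lpmx_bounded l A -> exists P, lpmx_rep A P /\ pge l P.
Proof.
move=> Al; have /choice[f fP] (ij : 'I_d.+1 * 'I_d.+1) := lpbounded_rep (Al ij.1 ij.2).
pose P : {poly M} := \poly_(k < \max_ij size (f ij)) \matrix_(i, j) (f (i, j))`_k.
have PE k i j : P`_k i j = (f (i, j))`_k.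
  rewrite coef_poly; case: ltnP => [_|fk]; rewrite mxE // nth_default //.
  by apply: leq_trans fk; apply: leq_bigmax.
exists P; split=> [i j k n|k i j]; rewrite PE; last exact: (fP (i, j)).2.
exact: (fP (i, j)).1.
Qed.

Lemma lpmxmul_rep l1 l2 A B P Q : lpmx_rep A P -> lpmx_rep B Q -> pge l1 P -> pge l2 Q ->
  lpmx_rep (lpmxmul q l1 l2 A B) (P * Q).
Proof.
move=> AP BQ lP lQ i j k n; rewrite coefM summxE lau_sumE /lpmxmul.
under [RHS]eq_bigr do rewrite mxE lau_sumE.
rewrite exchange_big; apply: eq_bigr => r _.
rewrite (@lpmul_rep _ _ _ _ (fun k => P`_k i r) (fun k => Q`_k r j)) ?lau_sumE //.
  by move=> a; apply: lP.
by move=> a; apply: lQ.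
Qed.

Lemma lpmx1_rep : lpmx_rep (@lpmx1 K d.+1) 1.
Proof.
move=> i j k n; rewrite coef1 /lpmx1 /lp1 /lp0.
by case: k => [|k]; rewrite mxE; case: (i == j).
Qed.

Lemma lp_invertible_rep l A P : lpmx_rep A P -> pge l P -> lp_invertible q l A ->
  exists Pi, P * Pi = 1 /\ Pi * P = 1.
Proof.
move=> AP lP [B [li [/lpmx_bounded_rep[Q [BQ lQ]] [AB BA]]]]; exists Q.
split; apply: (@lpmx_rep_inj (@lpmx1 K d.+1)); try exact: lpmx1_rep.
  by rewrite -AB; apply: lpmxmul_rep.
by rewrite -BA; apply: lpmxmul_rep.
Qed.

Lemma charmx_rep (D : 'M[{poly K}]_d.+1) :
  lpmx_rep (charmx D) ('X - (embm T D)%:P) /\ pge (charmx_low D) ('X - (embm T D)%:P).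
Proof.
have low i j : charmx_low D <= - (size (D i j))%:Z.
  rewrite /charmx_low (bigD1 i) //= (bigD1 j) //=; lia.
split=> [i j k n|k].
  rewrite coefB coefX coefC; case: k => [|[|k]]; rewrite /charmx /= ?andbT ?andbF /= !mxE.
  - by rewrite !sub0r.
  - by rewrite !subr0; case: (i == j).
  - by rewrite !subrr.
rewrite coefB; apply: mgeD.
  rewrite coefX; case: eqP => _; last exact: mge0.
  by apply: mgeW (@mge1 _ _ _); rewrite /charmx_low; lia.
apply/mgeN; rewrite coefC; case: eqP => _ i j; rewrite mxE; last exact: lge0.
by apply: (@lgeW _ _ (1 - (size (D i j))%:Z)); [have := low i j; lia|apply/lge_emb].
Qed.

Lemma lpdiag_rep lam (p : 'I_d.+1 -> {poly L}) : (forall i, lp_rep (lam (val i)) (nth 0 (p i))) ->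
  lpmx_rep (@lpdiag K d.+1 lam) (pdiag p).
Proof.
move=> lp_p i j k n; rewrite coef_pdiag /lpdiag /lp0.
by case: (i == j) => //=; apply: lp_p.
Qed.

Lemma expanding_invariant_factors (D : 'M[{poly K}]_d.+1) lam :
  invariant_factors q D lam -> expanding (embm T D) <-> np_pos_slopes (lam d).
Proof.
case=> [A [B [LA [LB [Ll [[Ab Bb Ai Bi E] [lamb div]]]]]]].
have [P [AP lP]] := lpmx_bounded_rep Ab; have [Q [BQ lQ]] := lpmx_bounded_rep Bb.
have [Pi [PPi PiP]] := lp_invertible_rep AP lP Ai.
have [Qi [QQi QiQ]] := lp_invertible_rep BQ lQ Bi.
have [Drep lowD] := charmx_rep D.
have /choice[p pP] (i : 'I_d.+1) := lpbounded_rep (lamb i (ltn_ord i)).1.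
have diagD : P * ('X - (embm T D)%:P) * Q = pdiag p.
  apply: (@lpmx_rep_inj (@lpdiag K d.+1 lam)); last by apply: lpdiag_rep => i; apply: (pP i).1.
  by rewrite -E; do 2?apply: lpmxmul_rep => //; apply: pgeM.
(* Right divisibility between neighbours is iterated up to the last factor; [inord] lets the
   induction run over natural numbers. *)
have divP (j : 'I_d.+1) : exists c, p ord_max = c * p j.
  have H m : (m < d.+1)%N -> (j <= m)%N -> exists c, p (inord m) = c * p j.
    elim: m => [|m IHm] md jm.
      by exists 1; rewrite mul1r; congr p; apply: val_inj; rewrite /= inordK //; lia.
    have [jm'|mj] := leqP j m; last first.
      by exists 1; rewrite mul1r; congr p; apply: val_inj; rewrite /= inordK //; lia.
    have [c cE] := IHm (ltnW md) jm'.
    have [_ [b [Lb [/lpbounded_rep[b' [bb' lb']] bE]]]] := div m md.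
    exists (b' * c); rewrite -mulrA -cE; apply: (@lp_rep_inj (lam m.+1)).
      by have := (pP (inord m.+1)).1; rewrite inordK.
    rewrite bE; apply: lpmul_poly => //; last exact: (pP _).2.
    by have := (pP (inord m)).1; rewrite inordK // ltnW.
  have [c cE] := H d (ltnSn d) (leq_ord j); exists c; rewrite -cE; congr p.
  by apply: val_inj; rewrite /= inordK.
have -> := @np_pos_slopesE Ll (lam d) (p ord_max) (lamb d (ltnSn d)).1 (pP ord_max).1.
split; first exact: (dominant_of_expanding PiP QiQ diagD ord_max).
exact: (expanding_of_dominant QQi diagD divP).
Qed.

End Matrices.

End FrobeniusTwist.

(** [#|F|] is a power of the characteristic, which [K] shares with [F] through [iota]; additivity
    and roots follow by iterating the [p]-th power map. *)
Lemma frobenius_card (F : finFieldType) (K : fieldType) (iota : {rmorphism F -> K}) :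
  (forall p : nat, p \in [pchar K] -> forall x : K, exists y : K, y ^+ p = x) ->
  (forall x y : K, (x - y) ^+ #|F| = x ^+ #|F| - y ^+ #|F|) /\
  (forall x : K, exists y, y ^+ #|F| = x).
Proof.
move=> perfK; have [p p_pr charF] := finPcharP F.
have charK := rmorph_pchar iota charF.
have [n ->] : exists n, #|F| = (p ^ n)%N by exists (logn p #|F|); exact: (card_pprimeChar charF).
split=> [x y|x].
  elim: n => [|n IHn]; first by rewrite !expr1.
  by rewrite expnSr !exprM IHn -!(pFrobenius_autE charK) rmorphB.
elim: n x => [|n IHn] x; first by exists x; rewrite expr1.
by have [y <-] := perfK p charK x; have [z <-] := IHn y; exists z; rewrite expnSr exprM.
Qed.

Theorem theorem6p6 (F : finFieldType) (K : fieldType)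
  (iota : {rmorphism F -> K})
  (perfK : forall p : nat, p \in [pchar K] -> forall x : K, exists y : K, y ^+ p = x)
  (theta : K) (d : nat) (hd : (0 < d)%N) (D : 'M[{poly K}]_d)
  (hD : is_tmodule theta D)
  (lam : nat -> lp K) (hlam : invariant_factors #|F| D lam) :
  (tmod_abelian #|F| D <-> tmod_tfinite #|F| D) /\
  (tmod_tfinite #|F| D <-> np_pos_slopes (lam d.-1)).
Proof.
(* With the dimension written as a successor, the square matrices form a nonzero ring, as
   polynomials over them require; the last index becomes [d]. *)
case: d hd D hD hlam => // d _ D _ hlam.
have [qB q_surj] := frobenius_card iota perfK.
have q_gt0 : (0 < #|F|)%N by apply/card_gt0P; exists 0.
pose T := frobenius_twisting q_gt0 qB q_surj.
have TN := frobenius_twistingN q_gt0 qB q_surj.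
have abE : tmod_abelian #|F| D <-> expanding (embm T D).
  by split; [exact: (expanding_of_abelian TN)|exact: (abelian_of_expanding TN)].
have tfE : tmod_tfinite #|F| D <-> expanding (embm T D).
  by split; [exact: (expanding_of_tfinite TN)|exact: (tfinite_of_expanding TN)].
have npE := expanding_invariant_factors q_gt0 qB q_surj hlam.
by rewrite abE tfE -npE.
Qed.
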